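(* For every $\lambda\in\mathbb{N}$ and every admissible function $f:\mathbb{N}\to\mathbb{N}$, $$\dim\Big\{x\in[0,1)\setminus\mathbb{Q}:\ \lim_{n\to\infty}\frac{L_n(x,\lambda)}{f(n)}=1\Big\}=1.$$
   Context: $\mathbb{N}=\{1,2,3,\dots\}$, and $\dim$ denotes Hausdorff dimension. Every $x\in[0,1)\setminus\mathbb{Q}$ has a unique continued fraction expansion $x=[a_1,a_2,a_3,\dots]=\cfrac{1}{a_1+\cfrac{1}{a_2+\cfrac{1}{a_3+\cdots}}}$ with partial quotients $a_n=a_n(x)\in\mathbb{N}$. For $n\in\mathbb{N}$, $x\in[0,1)\setminus\mathbb{Q}$ and $\lambda\in\mathbb{N}$, the fixed-symbol longest-run function is $L_n(x,\lambda)=\max_{0\le j\le n-1}\sum_{k=1}^{n-j}\prod_{i=1}^{k}\mathbf{1}_{a_{j+i}(x)=\lambda}\in\mathbb{N}\cup\{0\}$; equivalently, $L_n(x,\lambda)$ is the maximum length of a consecutive run of the value $\lambda$ among the first $n$ partial quotients $a_1(x),\dots,a_n(x)$ (equal to $0$ if $\lambda$ does not occur). A function $f:\mathbb{N}\to\mathbb{N}$ is called admissible if it is non-decreasing, unbounded, and $\lim_{n\to\infty}\frac{f(n+f(n))}{f(n)}=1$. *)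

(* Defs.v *)
From HB Require Import structures.
From mathcomp Require Import all_boot all_order all_algebra.
From mathcomp Require Import all_classical all_reals all_analysis.
From mathcomp Require Import ring lra.

Set Implicit Arguments.
Unset Strict Implicit.
Unset Printing Implicit Defensive.

Import Order.TTheory GRing.Theory Num.Theory.
Import numFieldNormedType.Exports.

Local Open Scope classical_set_scope.
Local Open Scope ring_scope.

(** ** Hausdorff dimension of subsets of the real line *)

(* The [0] in the supremum only matters for [set0], whose diameter is 0. *)
Definition diam (R : realType) (A : set R) : \bar R :=
  ereal_sup ([set 0%E] `|` [set `|p.1 - p.2|%:E | p in A `*` A]).

(* [diam A ^ s], with the convention that the empty set contributes 0 even
   for s = 0 (where a point contributes 0 ^ 0 = 1). *)
Definition diam_pow (R : realType) (s : R) (A : set R) : \bar R :=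
  if A == set0 then 0%E else poweR (diam A) s.

Definition hausdorff_premeasure (R : realType) (s delta : R) (A : set R) :
    \bar R :=
  ereal_inf [set (\sum_(0 <= k <oo) diam_pow s (U k))%E | U in
    [set U : nat -> set R |
       A `<=` \bigcup_k U k /\ forall k, (diam (U k) <= delta%:E)%E]].

(* The supremum over delta > 0 is the limit as delta tends to 0. *)
Definition hausdorff_measure (R : realType) (s : R) (A : set R) : \bar R :=
  ereal_sup [set hausdorff_premeasure s delta A | delta in
    [set delta : R | 0 < delta]].

Definition hausdorff_dim (R : realType) (A : set R) : \bar R :=
  ereal_inf [set s%:E | s in
    [set s : R | 0 <= s /\ hausdorff_measure s A = 0%E]].

(** ** Continued fractions *)

(* [cfrac_from R a i n] is the finite continued fraction
   [a_i, a_(i+1), ..., a_(i+n-1)] (n terms, 0 if n = 0). *)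
Fixpoint cfrac_from (R : realType) (a : nat -> nat) (i n : nat) : R :=
  if n is n'.+1 then ((a i)%:R + cfrac_from R a i.+1 n')^-1 else 0.

(* x = [a_1, a_2, a_3, ...]; the value [a 0] is irrelevant here and below. *)
Definition cfrac_expansion (R : realType) (x : R) (a : nat -> nat) : Prop :=
  (forall n, (0 < n)%N -> (0 < a n)%N) /\
  cfrac_from R a 1 n @[n --> \oo] --> x.

(* For x in [0, 1) irrational the expansion exists and its terms of index
   n >= 1 are unique: see [partial_quotientP] and [partial_quotient_unique]. *)
Definition partial_quotient (R : realType) (x : R) : nat -> nat :=
  xget (fun=> 0%N) [set a | cfrac_expansion x a].

Definition longest_run (R : realType) (n : nat) (x : R) (lambda : nat) : nat :=
  (\max_(0 <= j < n) \sum_(1 <= k < (n - j).+1)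
     \prod_(1 <= i < k.+1) (partial_quotient x (j + i) == lambda))%N.

(* A function on the positive integers is given by a function on [nat] whose
   value at 0 is irrelevant. *)
Definition admissible (R : realType) (f : nat -> nat) : Prop :=
  [/\ forall n, (0 < n)%N -> (0 < f n)%N,
      forall m n, (0 < m)%N -> (m <= n)%N -> (f m <= f n)%N,
      forall M, exists2 n, (0 < n)%N & (M < f n)%N &
      ((f (n + f n)%N)%:R / (f n)%:R : R) @[n --> \oo] --> (1 : R)].

(** ** Existence and uniqueness of the expansion *)

Section cfrac_theory.
Context (R : realType).
Implicit Types (x : R) (a b : nat -> nat).

Let pos_seq a := forall n, (0 < n)%N -> (0 < a n)%N.

Lemma cfrac_from_itv a i n : pos_seq a -> (0 < i)%N ->
  0 <= cfrac_from R a i n <= 1.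
Proof.
move=> a0; elim: n i => [|n IH] i i0 /=; first by rewrite lexx ler01.
have /andP[c0 c1] := IH i.+1 isT.
have ai1 : 1 <= (a i)%:R :> R by rewrite ler1n a0.
have d1 : 1 <= (a i)%:R + cfrac_from R a i.+1 n.
  by rewrite -[leLHS]addr0 lerD.
by rewrite invr_ge0 (le_trans ler01 d1) invf_le1 // (lt_le_trans ltr01 d1).
Qed.

Lemma irrational_lt01 x : irrational x -> 0 <= x <= 1 -> 0 < x < 1.
Proof.
move=> xI /andP[x0 x1]; rewrite !lt_neqAle x0 x1 !andbT.
apply/andP; split; apply/eqP => xE; apply: xI.
  by exists 0 => //; rewrite -xE rmorph0.
by exists 1 => //; rewrite xE rmorph1.
Qed.

Definition gauss x : R := x^-1 - (Num.truncn x^-1)%:R.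

Lemma gauss_irrational x n : irrational x -> irrational (x^-1 - n%:R).
Proof.
move=> xI [q _ qE]; apply: xI; exists (q + n%:R)^-1 => //.
by rewrite fmorphV rmorphD /= qE rmorph_nat subrK invrK.
Qed.

Lemma gauss_itv x : 0 < x -> 0 <= gauss x <= 1.
Proof.
move=> x0; have xV0 : 0 <= x^-1 by rewrite invr_ge0 ltW.
have /andP[l u] := truncn_itv xV0.
by rewrite /gauss subr_ge0 l lerBlDl -natr1 in u *; rewrite ltW.
Qed.

Let half_mul (k : nat) (u : R) : (0 < k)%N -> 0 <= u <= 1 ->
  0 <= (k%:R + u)^-1 * u <= 2^-1.
Proof.
move=> k0 /andP[u0 u1]; have k1 : 1 <= k%:R :> R by rewrite ler1n.
have d0 : 0 < k%:R + u by rewrite (lt_le_trans ltr01)// -[leLHS]addr0 lerD.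
rewrite mulr_ge0 ?invr_ge0 ?(ltW d0) //=.
rewrite mulrC ler_pdivrMr // ler_pdivlMl // mulr_natl mulr2n lerD //.
exact: le_trans u1 k1.
Qed.

Let invD_dist (k : nat) (u v : R) : 0 < k%:R + u -> 0 < k%:R + v ->
  `|(k%:R + u)^-1 - (k%:R + v)^-1| =
  (k%:R + u)^-1 * (k%:R + v)^-1 * `|u - v|.
Proof.
move=> u0 v0.
have -> : (k%:R + u)^-1 - (k%:R + v)^-1 =
  (k%:R + u)^-1 * (k%:R + v)^-1 * (v - u).
  rewrite (_ : v - u = (k%:R + v) - (k%:R + u)); last first.
    by rewrite opprD addrACA subrr add0r.
  by rewrite mulrBr mulfVK ?gt_eqF // mulrAC mulVf ?gt_eqF // mul1r.
rewrite normrM [`|v - u|]distrC [X in X * _ = _]ger0_norm //.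
by rewrite mulr_ge0 // invr_ge0 ltW.
Qed.

Lemma cfrac_from_dist a (y : nat -> R) :
  pos_seq a -> (forall i, (0 < i)%N -> 0 <= y i <= 1) ->
  (forall i, (0 < i)%N -> y i = ((a i)%:R + y i.+1)^-1) ->
  forall n i, (0 < i)%N -> `|cfrac_from R a i n - y i| <= 2 * 2^-1 ^+ n.
Proof.
move=> a0 y01 yE.
have dpos i (u : R) : (0 < i)%N -> 0 <= u <= 1 -> 0 < (a i)%:R + u.
  move=> i0 /andP[u0 _]; apply: (lt_le_trans ltr01).
  by rewrite -[leLHS]addr0 lerD // ler1n a0.
have dist1 i n : (0 < i)%N -> `|cfrac_from R a i n - y i| <= 1.
  move=> i0; have /andP[c0 c1] := cfrac_from_itv n a0 i0.
  have /andP[y0 y1] := y01 i i0.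
  by rewrite ler_norml; lra.
elim/ltn_ind => -[|[|n]] IH i i0.
- by rewrite expr0 mulr1 (le_trans (dist1 _ _ i0)) // ler1n.
- by rewrite expr1 divff ?dist1 // pnatr_eq0.
have y1 := y01 i.+1 isT; have y2 := y01 i.+2 isT.
have c1 := cfrac_from_itv n.+1 a0 (isT : (0 < i.+1)%N).
have c2 := cfrac_from_itv n a0 (isT : (0 < i.+2)%N).
have := IH n (leqnSn _) i.+2 isT.
have -> : cfrac_from R a i n.+2 = ((a i)%:R + cfrac_from R a i.+1 n.+1)^-1 by [].
rewrite (yE i i0) invD_dist ?dpos //.
have -> : `|cfrac_from R a i.+1 n.+1 - y i.+1| =
    cfrac_from R a i.+1 n.+1 * y i.+1 * `|cfrac_from R a i.+2 n - y i.+2|.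
  by rewrite [cfrac_from R a i.+1 n.+1]/= (yE i.+1 isT) invD_dist ?dpos.
move=> IHn.
have /andP[p0 p1] := half_mul (a0 _ i0) c1.
have /andP[q0 q1] := half_mul (a0 _ i0) y1.
set A := (_ + cfrac_from _ _ _ _)^-1 in p0 p1 *; set B := (_ + _)^-1 in q0 q1 *.
move: p0 p1 q0 q1 IHn; rewrite !exprS.
move: (cfrac_from R a i.+1 n.+1) (y i.+1) => p q.
move: (`|_|) (normr_ge0 (cfrac_from R a i.+2 n - y i.+2)) (2^-1 ^+ n) => D D0 E.
move=> p0 p1 q0 q1 DE.
rewrite [leLHS](_ : _ = (A * p) * (B * q) * D); last by ring.
rewrite [leRHS](_ : _ = 2^-1 * 2^-1 * (2 * E)); last by ring.
apply: ler_pM => //; first exact: mulr_ge0.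
exact: ler_pM.
Qed.

Lemma cfrac_expansion_exists x : 0 <= x < 1 -> irrational x ->
  exists a, cfrac_expansion x a.
Proof.
move=> /andP[x0 /ltW x1] xI.
pose y n := iter n.-1 gauss x.
have yP i : irrational (y i) /\ 0 < y i < 1.
  rewrite /y; elim: i.-1 => [|n [yI /andP[yn0 yn1]]] /=.
    by split => //; apply: irrational_lt01; rewrite // x0.
  have gI : irrational (gauss (iter n gauss x)) by exact: gauss_irrational.
  by split => //; apply: irrational_lt01 => //; exact: gauss_itv.
pose a n := Num.truncn (y n)^-1.
have a0 : pos_seq a.
  move=> n _; have [_ /andP[yn0 yn1]] := yP n.
  by rewrite /a truncn_gt0 invf_ge1 // ltW.
exists a; split => //; apply/cvgrPdist_le => e e0.
have yE i : (0 < i)%N -> y i = ((a i)%:R + y i.+1)^-1.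
  case: i => // i _; rewrite {2}/y /= -/(y i.+1) /gauss /a.
  by rewrite addrC subrK invrK.
have y01 i : (0 < i)%N -> 0 <= y i <= 1.
  by move=> _; have [_ /andP[? ?]] := yP i; rewrite !ltW.
have cv0 : (2 * 2^-1 ^+ n : R) @[n --> \oo] --> (0 : R).
  rewrite -(mulr0 2); apply: cvgM; first exact: cvg_cst.
  by apply: cvg_expr; rewrite ger0_norm ?invr_ge0 ?ler0n // invf_lt1 // ltr1n.
have /cvgrPdist_le /(_ e e0) := cv0.
apply: filterS => n; rewrite sub0r normrN ger0_norm; last first.
  by rewrite mulr_ge0 // exprn_ge0 // invr_ge0.
by apply: le_trans; rewrite distrC (cfrac_from_dist a0 y01 yE).
Qed.

Lemma cfrac_from_step a i x : pos_seq a -> (0 < i)%N -> irrational x ->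
  cfrac_from R a i n @[n --> \oo] --> x ->
  a i = Num.truncn x^-1 /\ cfrac_from R a i.+1 n @[n --> \oo] --> gauss x.
Proof.
move=> a0 i0 xI cx.
have lim01 j (z : R) : (0 < j)%N ->
    cfrac_from R a j n @[n --> \oo] --> z -> 0 <= z <= 1.
  move=> j0 cz; apply/andP; split.
    apply: (@cvgr_to_ge _ _ _ _ _ _ _ cz) => //.
    by apply: nearW => n; have /andP[] := cfrac_from_itv n a0 j0.
  apply: (@cvgr_to_le _ _ _ _ _ _ _ cz) => //.
  by apply: nearW => n; have /andP[] := cfrac_from_itv n a0 j0.
have /andP[x0 x1] := irrational_lt01 xI (lim01 _ _ i0 cx).
have cy : cfrac_from R a i.+1 n @[n --> \oo] --> x^-1 - (a i)%:R.
  have -> : (fun n => cfrac_from R a i.+1 n) =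
      (fun n => (cfrac_from R a i n.+1)^-1 - (a i)%:R).
    by apply/funext => n /=; rewrite invrK addrC addKr.
  apply: cvgB; last exact: cvg_cst.
  apply: cvgV; first by rewrite gt_eqF.
  by have := cx; rewrite -(cvg_shiftS (fun n => cfrac_from R a i n)).
have /andP[y0 y1] :=
  irrational_lt01 (gauss_irrational (n := a i) xI) (lim01 i.+1 _ isT cy).
suff aE : a i = Num.truncn x^-1 by split => //; rewrite /gauss -aE.
apply/esym/truncn_def; rewrite -subr_ge0 ltW //=.
by rewrite -natr1 -ltrBlDl.
Qed.

Lemma cfrac_expansion_unique x a b : irrational x ->
  cfrac_expansion x a -> cfrac_expansion x b ->
  forall n, (0 < n)%N -> a n = b n.
Proof.
move=> xI [a0 ca] [b0 cb].
suff H n : exists y, [/\ irrational y,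
    cfrac_from R a n.+1 m @[m --> \oo] --> y &
    cfrac_from R b n.+1 m @[m --> \oo] --> y].
  move=> [//|n] _; have [y [yI ya yb]] := H n.
  have [-> _] := cfrac_from_step (i := n.+1) a0 isT yI ya.
  by have [-> _] := cfrac_from_step (i := n.+1) b0 isT yI yb.
elim: n => [|n [y [yI ya yb]]]; first by exists x.
exists (gauss y); split; first exact: gauss_irrational.
- by have [_] := cfrac_from_step (i := n.+1) a0 isT yI ya.
- by have [_] := cfrac_from_step (i := n.+1) b0 isT yI yb.
Qed.

Lemma partial_quotientP x : 0 <= x < 1 -> irrational x ->
  cfrac_expansion x (partial_quotient x).
Proof.
move=> x01 xI; rewrite /partial_quotient.
by case: xgetP => // noP; have [a /noP] := cfrac_expansion_exists x01 xI.
Qed.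

Lemma partial_quotient_unique x a : 0 <= x < 1 -> irrational x ->
  cfrac_expansion x a ->
  forall n, (0 < n)%N -> partial_quotient x n = a n.
Proof.
move=> x01 xI; apply: cfrac_expansion_unique => //; exact: partial_quotientP.
Qed.

End cfrac_theory.

(* Main.v *)
Require Import Defs.
From mathcomp Require Import all_boot all_order all_algebra.
From mathcomp Require Import all_classical all_reals all_analysis.
From mathcomp Require Import ring lra zify.

(** The dimension is at most 1 because N intervals of length 1 / N cover
    [0, 1), which gives s-dimensional measure 0 for every s > 1
    ([hausdorff_measure_unit_itv]).

    For the lower bound fix s < 1. Almost all points of [0, 1) have partial
    quotients that grow slowly: the set S of irrationals whose n-th partial
    quotient is at most K rho ^ n has positive Lebesgue outer measure. This
    follows from the invariance of Gauss measure, which bounds the measure of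
    the set of x whose n-th iterate under the Gauss map is small, uniformly in
    n ([lebesgue_gauss_window], [bounded_digits_set_measure]).

    Points with the required runs are made from the points of S by inserting
    digits into their expansions, at positions and with values that do not
    depend on the point ([schedule]): f (s_k) digits lambda after each position
    s_k, where s_(k+1) = s_k + M f (s_k), and one digit lambda + 1 at every
    multiple of M outside these planted runs. The extra digits lambda + 1 cut
    accidental runs, so the longest run L_n up to n is at most f (n) + M, and
    it is at least f (s_k) as soon as the k-th planted run is complete.
    Admissibility makes f (s_(k+1) + f (s_(k+1))) asymptotic to f (s_k), hence
    L_n / f (n) tends to 1 ([run_length_ratio]).

    The inserted digits have density at most about 4 / M ([inserted_count]),
    and each of them multiplies the denominators of the convergents by at most
    lambda + 2 ([dominated_insert_digits]). Since denominators grow at least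
    like sqrt 2 ^ n, for large M this loss is smaller than any given power of
    the denominators. Two points are at distance about the inverse square of
    the denominator of their common convergent, so deleting the inserted digits
    is Hoelder continuous of exponent s ([insert_map_hoelder]). The preimage of
    an H^s-null set under a map with a Hoelder inverse is Lebesgue null
    ([hausdorff_null_hoelder_preimage]); as S is not, the set in question has
    positive H^s-measure for every s < 1. *)

Set Implicit Arguments.
Unset Strict Implicit.
Unset Printing Implicit Defensive.

Import Order.TTheory GRing.Theory Num.Theory.
Import numFieldNormedType.Exports.

Local Open Scope classical_set_scope.
Local Open Scope ring_scope.

(** * Denominators of continued fractions *)

Definition positive_digits (a : nat -> nat) :=
  forall n, (0 < n)%N -> (0 < a n)%N.

(** The denominators (q_n, q_(n-1)) of the convergents of [a_1, a_2, ...]. *)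
Fixpoint denominators (a : nat -> nat) (n : nat) : nat * nat :=
  if n is n'.+1 then
    let q := denominators a n' in (a n * q.1 + q.2, q.1)%N
  else (1, 0)%N.

Notation den a n := (denominators a n).1.

Lemma den_monotone a n : positive_digits a ->
  ((denominators a n).2 <= den a n)%N /\ (0 < den a n)%N.
Proof.
move=> a0; elim: n => [//|n [IH1 IH2]] /=.
have := a0 n.+1 isT; move: (a n.+1) (den a n) IH1 IH2 => c q IH1 IH2 c0.
by split; nia.
Qed.

Lemma den_double a n : positive_digits a -> (2 * den a n <= den a n.+2)%N.
Proof.
move=> a0 /=; have [] := den_monotone n a0.
have := a0 n.+1 isT; have := a0 n.+2 isT.
move: (a n.+1) (a n.+2) (denominators a n) => c d [q q'] /= d0 c0 qq q0.
apply: leq_trans (_ : d * (c * q) + q <= _)%N; last first.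
  by rewrite leq_add2r leq_mul2l leq_addr orbT.
by rewrite mulnA mul2n -addnn leq_add2r leq_pmull // muln_gt0 d0.
Qed.

(** Squared denominators at least quadruple every two digits; the factor 2 on
    the right absorbs an odd number of digits. *)
Lemma den_growth a n : positive_digits a -> (2 ^ n <= 2 * den a n ^ 2)%N.
Proof.
move=> a0; elim/ltn_ind: n => -[|[|n]] IH //.
  have [_ q0] := den_monotone 1 a0.
  by rewrite expn1 -[leqLHS]muln1 leq_mul2l /= expn_gt0 q0.
have := IH n (leqnSn _); have := den_double n a0.
move: (den a n.+2) (den a n) => p q pq tq.
rewrite (_ : 2 ^ n.+2 = 4 * 2 ^ n)%N; last by rewrite !expnS mulnA.
rewrite -!mulnn in tq *.
by have : (2 * q * (2 * q) <= p * p)%N by [exact: leq_mul]; lia.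
Qed.

(** Appending further digits turns a pair (q, q') into q A + q' B with
    0 <= B <= A, that is q (A - B) + (q + q') B. Comparing q and q + q' is
    therefore enough to compare all later denominators, and unlike comparing q
    and q' it survives the insertion of a digit, which puts q in the place
    of q'. *)
Definition dominated (c : nat) (p q : nat * nat) :=
  (p.1 <= c * q.1)%N /\ (p.1 + p.2 <= c * (q.1 + q.2))%N.

Lemma dominated_common c p q d : (0 < d)%N -> dominated c p q ->
  dominated c (d * p.1 + p.2, p.1)%N (d * q.1 + q.2, q.1)%N.
Proof.
by case: p q => [p p'] [q q'] d0 [/= h1 h2]; split => /=; nia.
Qed.

(** As p' <= p, the new digit changes p into d p + p' <= (d + 1) p and p + p'
    into (d + 1) p + p' <= (d + 1) (p + p'). *)
Lemma dominated_insert c p q d : (p.2 <= p.1)%N -> dominated c p q ->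
  dominated (d.+1 * c) (d * p.1 + p.2, p.1)%N q.
Proof.
by case: p q => [p p'] [q q'] /= pp [/= h1 h2]; split => /=; nia.
Qed.

Section distance.
Context (R : realType).

(** Here y 0 = [a_1, ..., a_(n-1), a_n + y n]. Only finitely many digits are
    involved, so truncated and infinite expansions obey the same distance
    estimates. *)
Definition orbit_upto (a : nat -> nat) (n : nat) (y : nat -> R) :=
  (forall j, 0 <= y j <= 1) /\
  (forall j, (j < n)%N -> y j = ((a j.+1)%:R + y j.+1)^-1).

(** One application of t |-> 1 / (a + t) multiplies distances by the product of
    the two images, and D_n = q_n + q_(n-1) y_n satisfies D_(n+1) y_n = D_n:
    the factors accumulated on both sides agree. *)
Lemma orbit_distance a n y z : positive_digits a ->
  orbit_upto a n y -> orbit_upto a n z ->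
  `|y 0%N - z 0%N| *
    (((den a n)%:R + (denominators a n).2%:R * y n) *
     ((den a n)%:R + (denominators a n).2%:R * z n)) = `|y n - z n|.
Proof.
move=> a0; elim: n => [|n IH] [y01 yE] [z01 zE].
  by rewrite /= !mul0r !addr0 !mulr1.
have yn : orbit_upto a n y by split => // j jn; apply: yE; exact: ltnW.
have zn : orbit_upto a n z by split => // j jn; apply: zE; exact: ltnW.
have step (w : nat -> R) : (forall j, 0 <= w j <= 1) ->
    w n = ((a n.+1)%:R + w n.+1)^-1 ->
    0 < (a n.+1)%:R + w n.+1 /\
    ((a n.+1)%:R * (den a n)%:R + (denominators a n).2%:R) +
      (den a n)%:R * w n.+1 =
    ((den a n)%:R + (denominators a n).2%:R * w n) * ((a n.+1)%:R + w n.+1).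
  move=> w01 wE; have /andP[w0 _] := w01 n.+1.
  have d0 : 0 < (a n.+1)%:R + w n.+1 by rewrite ltr_pwDl // ltr0n a0.
  by split => //; rewrite wE; field; rewrite gt_eqF.
have [dy ey] := step y y01 (yE n (leqnn _)).
have [dz ez] := step z z01 (zE n (leqnn _)).
rewrite /= !natrD !natrM ey ez.
rewrite [LHS](_ : _ = `|y 0%N - z 0%N| *
    (((den a n)%:R + (denominators a n).2%:R * y n) *
     ((den a n)%:R + (denominators a n).2%:R * z n)) *
    (((a n.+1)%:R + y n.+1) * ((a n.+1)%:R + z n.+1))); last by ring.
rewrite IH // (yE n (leqnn _)) (zE n (leqnn _)).
rewrite -[X in _ * X]ger0_norm; last by rewrite mulr_ge0 // ltW.
rewrite -normrM distrC; congr `|_|; field.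
by rewrite !gt_eqF.
Qed.

Lemma orbit_distance_le a n y z : positive_digits a ->
  orbit_upto a n y -> orbit_upto a n z ->
  `|y 0%N - z 0%N| * (den a n)%:R ^+ 2 <= `|y n - z n|.
Proof.
move=> a0 oy oz; rewrite -(orbit_distance a0 oy oz).
have [[/(_ n)/andP[y0 _] _] [/(_ n)/andP[z0 _] _]] := (oy, oz).
apply: ler_wpM2l => //; rewrite expr2 ler_pM ?ler0n // lerDl mulr_ge0 //.
Qed.

Lemma orbit_distance_ge a n y z : positive_digits a ->
  orbit_upto a n y -> orbit_upto a n z ->
  `|y n - z n| <= `|y 0%N - z 0%N| * (4 * (den a n)%:R ^+ 2).
Proof.
move=> a0 oy oz; rewrite -(orbit_distance a0 oy oz).
have [[/(_ n)/andP[y0 y1] _] [/(_ n)/andP[z0 z1] _]] := (oy, oz).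
have [q'q q0] := den_monotone n a0.
have bnd w : 0 <= w <= 1 ->
    (den a n)%:R + (denominators a n).2%:R * w <= 2 * (den a n)%:R.
  move=> /andP[w0 w1]; rewrite [leRHS]mulr_natl mulr2n lerD2l.
  by rewrite -[leRHS]mulr1 ler_pM // ler_nat.
apply: ler_wpM2l => //.
rewrite [leRHS](_ : _ = (2 * (den a n)%:R) * (2 * (den a n)%:R)); last by ring.
by rewrite ler_pM ?addr_ge0 ?mulr_ge0 ?bnd ?y0 ?z0.
Qed.

(** Points of [0, 1] with n common digits are exponentially close, by
    [den_growth]. *)
Lemma orbit_contract a n y z : positive_digits a ->
  orbit_upto a n y -> orbit_upto a n z ->
  `|y 0%N - z 0%N| <= 2 * 2^-1 ^+ n.
Proof.
move=> a0 oy oz; have := orbit_distance_le a0 oy oz.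
have [[/(_ n)/andP[y0 y1] _] [/(_ n)/andP[z0 z1] _]] := (oy, oz).
have d1 : `|y n - z n| <= 1 by rewrite ler_norml; lra.
move=> /le_trans /(_ d1) => h.
rewrite exprVn -[leLHS]mul1r ler_pdivlMr ?exprn_gt0 //.
rewrite mul1r.
apply: le_trans (_ : `|y 0%N - z 0%N| * (2 * (den a n)%:R ^+ 2) <= _); last lra.
apply: ler_wpM2l => //; rewrite -!natrX -natrM ler_nat; exact: den_growth.
Qed.

End distance.

Lemma eq_orbit_upto (R : realType) a b n (y : nat -> R) :
  (forall j, (0 < j <= n)%N -> a j = b j) ->
  orbit_upto a n y -> orbit_upto b n y.
Proof. by move=> ab [y01 yE]; split => // j jn; rewrite yE // ab //; lia. Qed.

(** * Infinite continued fractions *)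

Section infinite_cfrac.
Context (R : realType).

(** The value of [a_(i+1), a_(i+2), ...], which is also the i-th iterate of the
    Gauss map at [a_1, a_2, ...]. *)
Definition cfrac_tail (a : nat -> nat) (i : nat) : R :=
  lim (cfrac_from R a i.+1 n @[n --> \oo]).

Lemma cvg_geometric_half : (2 * 2^-1 ^+ n : R) @[n --> \oo] --> (0 : R).
Proof.
rewrite -(mulr0 2); apply: cvgM; first exact: cvg_cst.
by apply: cvg_expr; rewrite ger0_norm ?invr_ge0 ?ler0n // invf_lt1 // ltr1n.
Qed.

Lemma cfrac_from_orbit a i n k : positive_digits a ->
  orbit_upto (fun j => a (i + j)%N) n
    (fun j => cfrac_from R a (i + j).+1 (n + k - j)).
Proof.
move=> a0; split=> [j|j jn]; first exact: cfrac_from_itv.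
by rewrite (_ : (n + k - j = (n + k - j.+1).+1)%N) /= ?addnS //; lia.
Qed.

(** Any two truncations beyond N terms are orbits with N common digits, so the
    truncations form a Cauchy sequence. *)
Lemma cfrac_from_cvg a i : positive_digits a ->
  cfrac_from R a i.+1 n @[n --> \oo] --> cfrac_tail a i.
Proof.
move=> a0; apply: cauchy_cvg; apply: cauchy_exP => e e0.
have /cvgrPdist_lt /(_ e e0)[N _ Ne] := cvg_geometric_half.
exists (cfrac_from R a i.+1 N); exists N => // n /= Nn.
have a0' : positive_digits (fun j => a (i + j)%N).
  by move=> j j0; rewrite a0 // addn_gt0 j0 orbT.
have := orbit_contract a0' (cfrac_from_orbit i N 0 a0)
  (cfrac_from_orbit i N (n - N) a0).
rewrite !addn0 !subn0 subnKC // => /le_lt_trans; apply.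
have := Ne N (leqnn N).
rewrite sub0r normrN ger0_norm // mulr_ge0 // exprn_ge0 // invr_ge0 //.
Qed.

Lemma cfrac_tail01 a i : positive_digits a -> 0 <= cfrac_tail a i <= 1.
Proof.
move=> a0; have cz := cfrac_from_cvg (i := i) a0; apply/andP; split.
  apply: (@cvgr_to_ge _ _ _ _ _ _ _ cz) => //.
  by apply: nearW => n; have /andP[] := cfrac_from_itv R n a0 (ltn0Sn i).
apply: (@cvgr_to_le _ _ _ _ _ _ _ cz) => //.
by apply: nearW => n; have /andP[] := cfrac_from_itv R n a0 (ltn0Sn i).
Qed.

Lemma cfrac_tail_rec a i : positive_digits a ->
  cfrac_tail a i = ((a i.+1)%:R + cfrac_tail a i.+1)^-1.
Proof.
move=> a0; have cx := cfrac_from_cvg (i := i) a0.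
suff cy : cfrac_from R a i.+1 n @[n --> \oo] -->
    ((a i.+1)%:R + cfrac_tail a i.+1)^-1.
  exact: (cvg_unique (@Rhausdorff R) cx cy).
rewrite -(cvg_shiftS (fun n => cfrac_from R a i.+1 n)) /=.
apply: cvgV.
  have /andP[t0 _] := cfrac_tail01 i.+1 a0.
  by rewrite gt_eqF // ltr_pwDl // ltr0n a0.
by apply: cvgD; [exact: cvg_cst|exact: cfrac_from_cvg].
Qed.

Lemma cfrac_tail_gt0 a i : positive_digits a -> 0 < cfrac_tail a i.
Proof.
move=> a0; rewrite cfrac_tail_rec // invr_gt0.
by have /andP[t0 _] := cfrac_tail01 i.+1 a0; rewrite ltr_pwDl // ltr0n a0.
Qed.

Lemma cfrac_tail_lt1 a i : positive_digits a -> cfrac_tail a i < 1.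
Proof.
move=> a0; have t0 := cfrac_tail_gt0 i.+1 a0.
have a1 : 1 <= (a i.+1)%:R :> R by rewrite ler1n a0.
by rewrite cfrac_tail_rec // invf_lt1; lra.
Qed.

Lemma cfrac_tail_orbit a n : positive_digits a -> orbit_upto a n (cfrac_tail a).
Proof.
by move=> a0; split=> [j|j _]; [exact: cfrac_tail01|exact: cfrac_tail_rec].
Qed.

(** Infinite descent: if a tail is p / q then p < q, and the next tail
    q / p - a is a fraction with the smaller denominator p. *)
Lemma cfrac_tail_neq_frac a : positive_digits a ->
  forall q i p, (0 < q)%N -> cfrac_tail a i <> p%:R / q%:R.
Proof.
move=> a0; elim/ltn_ind => q IH i p q0 tE.
have qR : 0 < q%:R :> R by rewrite ltr0n.
have t0 := cfrac_tail_gt0 i a0; have t1 := cfrac_tail_lt1 i a0.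
have p0 : (0 < p)%N.
  by rewrite -(ltr0n R) -(pmulr_lgt0 _ (_ : 0 < q%:R^-1)) ?invr_gt0 // -tE.
have pq : (p < q)%N by rewrite -(ltr_nat R) -[ltRHS]mul1r -ltr_pdivrMr // -tE.
have pR : 0 < p%:R :> R by rewrite ltr0n.
have sE : cfrac_tail a i.+1 = q%:R / p%:R - (a i.+1)%:R.
  rewrite -[q%:R / p%:R]invf_div -tE (cfrac_tail_rec i a0).
  by rewrite invrK addrAC subrr add0r.
have s0 := cfrac_tail_gt0 i.+1 a0.
have le : (a i.+1 * p <= q)%N.
  rewrite -(ler_nat R) natrM -ler_pdivlMr //; lra.
apply: (IH p pq i.+1 (q - a i.+1 * p)%N p0).
by rewrite sE natrB // natrM mulrBl mulfK // gt_eqF.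
Qed.

Lemma cfrac_tail_irrational a i : positive_digits a ->
  irrational (cfrac_tail a i).
Proof.
move=> a0 [r _ rE]; have t0 := cfrac_tail_gt0 i a0.
have r0 : 0 < r by rewrite -(ltr0q R) rE.
apply: (@cfrac_tail_neq_frac a a0 `|denq r|%N i `|numq r|%N).
  by rewrite absz_gt0 denq_neq0.
rewrite -rE /ratr; congr (_ / _).
  by rewrite -[RHS]mulrz_nat natz gez0_abs // numq_ge0 ltW.
by rewrite -[RHS]mulrz_nat natz gez0_abs.
Qed.

Lemma partial_quotient_cfrac a n : positive_digits a -> (0 < n)%N ->
  partial_quotient (cfrac_tail a 0) n = a n.
Proof.
move=> a0; apply: partial_quotient_unique.
- by rewrite ltW ?cfrac_tail_gt0 ?cfrac_tail_lt1.
- exact: cfrac_tail_irrational.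
- by split => //; exact: cfrac_from_cvg.
Qed.

End infinite_cfrac.

Section gap.
Context (R : realType).
Implicit Types c : nat -> nat.

Lemma cfrac_tail_ge c i (D : R) : positive_digits c ->
  (c i.+1)%:R + 1 <= D -> D^-1 <= cfrac_tail R c i.
Proof.
move=> c0 cD; rewrite (cfrac_tail_rec _ _ c0).
have /andP[t0 t1] := cfrac_tail01 R i.+1 c0.
have ci : 1 <= (c i.+1)%:R :> R by rewrite ler1n c0.
by rewrite lef_pV2 ?posrE; lra.
Qed.

(** Let al < be be the first digits of the tails 1 / (al + x1) and
    1 / (be + y1). The denominators differ by at least 1 - x1, which could be
    small; but x1 <= 1 / (1 + x2) where x2 >= 1 / D, since the digit of c two
    places later is bounded too. *)
Lemma cfrac_tail_gap c c' m (D : R) : positive_digits c -> positive_digits c' ->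
  (c m.+1 < c' m.+1)%N -> (c m.+1)%:R + 1 <= D -> (c' m.+1)%:R + 1 <= D ->
  (c m.+3)%:R + 1 <= D ->
  (2 * D ^+ 3)^-1 <= cfrac_tail R c m - cfrac_tail R c' m.
Proof.
move=> c0 c'0 cc' cD c'D cD3.
have c1 : 1 <= (c m.+1)%:R :> R by rewrite ler1n c0.
have D0 : 0 < D by lra.
have x0 := cfrac_tail_ge c0 cD; have y0 := cfrac_tail_ge c'0 c'D.
have x2 := cfrac_tail_ge c0 cD3.
have c2 : 1 <= (c m.+2)%:R :> R by rewrite ler1n c0.
have x1E := cfrac_tail_rec R m.+1 c0.
have /andP[x10 x11] := cfrac_tail01 R m.+1 c0.
have /andP[x20 x21] := cfrac_tail01 R m.+2 c0.
have /andP[y10 y11] := cfrac_tail01 R m.+1 c'0.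
have gap1 : (2 * D)^-1 <= 1 - cfrac_tail R c m.+1.
  rewrite x1E; set t := cfrac_tail R c m.+2 in x2 x20 x21 *.
  have le1 : ((c m.+2)%:R + t)^-1 <= (1 + t)^-1 by rewrite lef_pV2 ?posrE; lra.
  apply: le_trans (_ : 1 - (1 + t)^-1 <= _); last lra.
  rewrite [leRHS](_ : _ = t / (1 + t)); last by field; rewrite gt_eqF; lra.
  rewrite invfM mulrC; apply: ler_pM; rewrite ?invr_ge0 //; try lra.
  by rewrite lef_pV2 ?posrE; lra.
have cc'R : (c m.+1)%:R + 1 <= (c' m.+1)%:R :> R by rewrite natr1 ler_nat.
have := cfrac_tail_rec R m c0; have := cfrac_tail_rec R m c'0.
set x := cfrac_tail R c m in x0 *; set y := cfrac_tail R c' m in y0 *.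
set x1 := cfrac_tail R c m.+1 in x1E x10 x11 gap1 *.
set y1 := cfrac_tail R c' m.+1 in y10 y11 *.
set al := _%:R in c1 cD cc'R *; set be := _%:R in c'D cc'R *.
move=> yE xE; have -> : x - y = ((be + y1) - (al + x1)) * (x * y).
  by rewrite xE yE; field; rewrite !gt_eqF //; lra.
have D2 : (D ^+ 2)^-1 <= x * y.
  by rewrite expr2 invfM; apply: ler_pM; rewrite ?invr_ge0 // ltW.
rewrite exprS mulrA invfM; apply: ler_pM => //; last lra.
- by rewrite invr_ge0 mulr_ge0 // ltW.
- by rewrite invr_ge0 exprn_ge0 // ltW.
Qed.

Lemma cfrac_tail_dist_gap c c' m (D : R) :
  positive_digits c -> positive_digits c' -> c m.+1 != c' m.+1 ->
  (forall i, (0 < i <= m.+3)%N -> (c i)%:R + 1 <= D /\ (c' i)%:R + 1 <= D) ->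
  (2 * D ^+ 3)^-1 <= `|cfrac_tail R c m - cfrac_tail R c' m|.
Proof.
move=> c0 c'0 cc' D1.
have [h1 h1'] := D1 m.+1 ltac:(lia); have [h3 h3'] := D1 m.+3 (ltac:(lia)).
case: (ltngtP (c m.+1) (c' m.+1)) cc' => // lt _.
  by apply: le_trans (ler_norm _); exact: cfrac_tail_gap.
by rewrite distrC; apply: le_trans (ler_norm _); exact: cfrac_tail_gap.
Qed.

End gap.

(** * Gauss measure and sets of points with slowly growing digits *)

Section gauss_measure.
Context (R : realType).
Implicit Types (x u v : R).

(** [lebesgue_measure] is the outer measure that extends interval length, as a
    function on all sets; monotonicity and countable subadditivity hold without
    measurability. *)
Lemma lebesgue_measure_le (A B : set R) :
  A `<=` B -> (lebesgue_measure A <= lebesgue_measure B)%E.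
Proof.
rewrite /lebesgue_measure /lebesgue_stieltjes_measure /measure_extension => AB.
by apply: le_mu_ext.
Qed.

Lemma lebesgue_measure_subadditive (F : nat -> set R) :
  (lebesgue_measure (\bigcup_k F k) <=
   \sum_(0 <= k <oo) lebesgue_measure (F k))%E.
Proof.
rewrite /lebesgue_measure /lebesgue_stieltjes_measure /measure_extension.
by apply: mu_ext_sigma_subadditive => X; exact: measure_ge0.
Qed.

Lemma nneseries_le_bound (g : nat -> \bar R) (c : \bar R) :
  (forall n, 0 <= g n)%E ->
  (forall N, \sum_(0 <= k < N) g k <= c)%E -> (\sum_(0 <= k <oo) g k <= c)%E.
Proof.
move=> g0 gc; apply: lime_le; last exact: nearW.
by apply: is_cvg_nneseries => n _ _; exact: g0.
Qed.

Lemma lebesgue_measure_bigcup_le (F : nat -> set R) (g : nat -> R) (c : R) :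
  (forall k, lebesgue_measure (F k) <= (g k)%:E)%E ->
  (forall N, \sum_(0 <= k < N) g k <= c) ->
  (lebesgue_measure (\bigcup_k F k) <= c%:E)%E.
Proof.
move=> Fg gc; apply: le_trans (lebesgue_measure_subadditive F) _.
apply: nneseries_le_bound => [n|N]; first exact: measure_ge0.
apply: le_trans (_ : \sum_(0 <= k < N) (g k)%:E <= _)%E; first exact: lee_sum.
by rewrite sumEFin lee_fin.
Qed.

Lemma gauss_iter x n : 0 <= x < 1 -> irrational x ->
  irrational (iter n (@gauss R) x) /\ 0 < iter n (@gauss R) x < 1.
Proof.
move=> /andP[x0 /ltW x1] xI; elim: n => [|n [yI /andP[y0 y1]]] /=.
  by split => //; apply: irrational_lt01; rewrite // x0.
have gI : irrational (gauss (iter n (@gauss R) x)) by exact: gauss_irrational.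
by split => //; apply: irrational_lt01 => //; exact: gauss_itv.
Qed.

Definition gauss_window n u v : set R :=
  [set x | [/\ 0 <= x < 1, irrational x & u <= iter n (@gauss R) x <= v]].

(** Up to the factor ln 2, the Gauss measure of [u, v]. *)
Definition log_length u v := ln (1 + v) - ln (1 + u).

(** The density 1 / (1 + t) is at least 1 / 2 on [0, 1]. The proof applies
    ln (1 + t) <= t to (1 + u) / (1 + v). *)
Lemma length_le_log_length u v : 0 <= u <= v -> v <= 1 ->
  v - u <= 2 * log_length u v.
Proof.
move=> /andP[u0 uv] v1; rewrite /log_length.
have vP : 0 < 1 + v by lra.
have uP : 0 < 1 + u by lra.
have : ln ((1 + u) / (1 + v)) <= - ((v - u) / 2).
  rewrite [(1 + u) / (1 + v)](_ : _ = 1 + - ((v - u) / (1 + v))); last first.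
    by field; rewrite gt_eqF.
  apply: le_trans (le_ln1Dx _) _.
    by rewrite ltrN2 ltr_pdivrMr //; lra.
  rewrite lerN2; apply: ler_wpM2l; first lra.
  by rewrite lef_pV2 // ?posrE //; lra.
by rewrite ln_div ?posrE // => ?; lra.
Qed.

Lemma log_length_branch k u : 0 <= u ->
  ln (1 + (k.+1%:R + u)^-1) = ln (k.+2%:R + u) - ln (k.+1%:R + u).
Proof.
move=> u0; have p1 : 0 < k.+1%:R + u by rewrite ltr_pwDl.
have p2 : 0 < k.+2%:R + u by rewrite ltr_pwDl.
rewrite -ln_div ?posrE //; congr ln.
by rewrite -(natr1 k.+1) addrAC mulrDl divff ?gt_eqF // mul1r.
Qed.

(** Gauss measure is invariant under the Gauss map, whose inverse branches are
    t |-> 1 / (k + 1 + t). By [log_length_branch] the partial sums telescope,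
    and the term left over at N has the right sign. *)
Lemma log_length_branches N u v : 0 <= u <= v ->
  \sum_(0 <= k < N) log_length (k.+1%:R + v)^-1 (k.+1%:R + u)^-1 <=
  log_length u v.
Proof.
move=> /andP[u0 uv]; have v0 := le_trans u0 uv.
rewrite /log_length.
under eq_bigr do rewrite !log_length_branch //.
rewrite sumrB (telescope_sumr (fun k => ln (k.+1%:R + u))) //.
rewrite (telescope_sumr (fun k => ln (k.+1%:R + v))) //.
have : ln (N.+1%:R + u) <= ln (N.+1%:R + v).
  by rewrite ler_ln ?posrE ?lerD2l // ltr_pwDl.
by move=> ?; lra.
Qed.

Lemma gauss_window_branches n u v : 0 <= u <= v ->
  gauss_window n.+1 u v `<=`
  \bigcup_k gauss_window n (k.+1%:R + v)^-1 (k.+1%:R + u)^-1.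
Proof.
move=> /andP[u0 uv] x [x01 xI /= /andP[ux xv]].
have v0 := le_trans u0 uv.
have [_ /andP[y0 y1]] := gauss_iter n x01 xI.
move: ux xv; set y := iter n _ x in y0 y1 *; rewrite /gauss.
have : (0 < Num.truncn y^-1)%N by rewrite truncn_gt0 invf_ge1 // ltW.
case: (Num.truncn _) => // k _ ux xv; exists k => //; split => //.
have kv : 0 < k.+1%:R + v by rewrite ltr_pwDl.
have ku : 0 < k.+1%:R + u by rewrite ltr_pwDl.
rewrite -/y -[X in _ <= X <= _]invrK !lef_pV2 ?posrE ?invr_gt0 //.
by apply/andP; split; lra.
Qed.

(** By induction on n, replacing [u, v] by its preimages under the branches of
    the Gauss map, which does not increase [log_length]. *)
Lemma lebesgue_gauss_window n u v : 0 <= u <= v -> v <= 1 ->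
  (lebesgue_measure (gauss_window n u v) <= (2 * log_length u v)%:E)%E.
Proof.
elim: n u v => [|n IH] u v uv v1.
  apply: le_trans (_ : lebesgue_measure (`[u, v]%classic : set R) <= _)%E.
    by apply: lebesgue_measure_le => x [_ _ /= xuv]; rewrite in_itv.
  rewrite lebesgue_measure_itv /= lte_fin.
  have /andP[u0 uv'] := uv.
  have l0 := length_le_log_length uv v1.
  by case: ifP => _; rewrite ?EFinB // -?EFinB lee_fin //; lra.
apply: (le_trans (lebesgue_measure_le (@gauss_window_branches n u v uv))).
have /andP[u0 uv'] := uv.
have v0 := le_trans u0 uv'.
apply: (@lebesgue_measure_bigcup_le _
  (fun k => 2 * log_length (k.+1%:R + v)^-1 (k.+1%:R + u)^-1)).
  move=> k; apply: IH.
    have ku : 0 < k.+1%:R + u by rewrite ltr_pwDl.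
    have kv : 0 < k.+1%:R + v by rewrite ltr_pwDl.
    by rewrite invr_ge0 ltW //= lef_pV2 // lerD2l.
  rewrite invf_le1 ?ltr_pwDl // -[leLHS]addr0 lerD // ler1n //.
move=> N; rewrite -mulr_sumr; apply: ler_wpM2l => //.
exact: log_length_branches.
Qed.

(** The lower bound on the n-th iterate bounds the digit of index n + 1 by B n,
    see [gauss_digits_le]. *)
Definition bounded_digits_set (B : nat -> R) : set R :=
  [set x | [/\ 0 <= x < 1, irrational x &
    forall n, (B n)^-1 < iter n (@gauss R) x]].

(** The points excluded by the n-th condition have measure at most
    2 ln (1 + 1 / B n) <= 2 / B n; in total this removes at most half of
    [0, 1), besides the rationals. *)
Lemma bounded_digits_set_measure (B : nat -> R) :
  (forall n, 1 <= B n) -> (forall N, \sum_(0 <= n < N) (B n)^-1 <= 4^-1) ->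
  (0 < lebesgue_measure (bounded_digits_set B))%E.
Proof.
move=> B1 Bsum; set S := bounded_digits_set B.
pose bad := \bigcup_n gauss_window n 0 (B n)^-1.
have badm : (lebesgue_measure bad <= (2^-1)%:E)%E.
  apply: (@lebesgue_measure_bigcup_le _ (fun n => 2 * (B n)^-1)).
    move=> n; have Bn : 0 < B n := lt_le_trans ltr01 (B1 n).
    apply: le_trans (lebesgue_gauss_window n _ _) _.
    - by rewrite lexx invr_ge0 ltW.
    - by rewrite invf_le1.
    rewrite lee_fin /log_length addr0 ln1 subr0; apply: ler_wpM2l => //.
    by apply: le_ln1Dx; rewrite (lt_trans (_ : -1 < 0)) ?invr_gt0 //; lra.
  by move=> N; rewrite -mulr_sumr; have := Bsum N; lra.
(* [0, 1) is covered by S, the rationals and the exceptional set. *)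
pose F k := if k is k'.+1 then (if k' is k''.+1 then
  (if k'' is 0 then bad else set0) else range ratr) else S.
have cover : `[0, 1[%classic `<=` \bigcup_k F k.
  move=> x /=; rewrite in_itv /= => x01.
  have [xQ|xI] := pselect (rational x); first by exists 1%N.
  have [xS|/existsNP[n /negP]] :=
    pselect (forall n, (B n)^-1 < iter n (@gauss R) x); first by exists 0%N.
  rewrite -leNgt => xn; exists 2%N => //; exists n => //; split => //.
  by have [_ /andP[/ltW -> _]] := gauss_iter n x01 xI.
rewrite ltNge; apply/negP => S0.
have := le_trans (lebesgue_measure_le cover) (@lebesgue_measure_bigcup_le F
  (fun k => if k == 2%N then 2^-1 else 0) 2^-1 _ _).
rewrite lebesgue_measure_itv /= lte01 oppr0 adde0 lee_fin.
move=> h; suff : (1 : R) <= 2^-1 by lra.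
apply: h.
  move=> [|[|[|k]]] //=; first by rewrite lebesgue_measure_rat.
  by rewrite measure0.
elim=> [|N IH]; first by rewrite big_nil.
have [N3|N3] := leqP N 2.
  move: IH; rewrite big_nat_recr //=.
  case: eqP => [->|_]; last by rewrite addr0.
  by rewrite !big_nat_recr // big_nil /= !add0r.
by rewrite big_nat_recr //= gtn_eqF // addr0.
Qed.

End gauss_measure.

(** * Inserting digits into an expansion *)

Section insertion.
Local Open Scope nat_scope.
Variable sigma : nat -> option nat.

(** An insertion rule puts the digit d at position i when [sigma i = Some d],
    and copies the next digit of the given sequence when [sigma i = None]. *)
Fixpoint kept m := if m is m'.+1 then kept m' + (sigma m == None) else 0.

(** A copied position is counted in [kept i], which is therefore the index,
    starting from 1, of the digit copied there. *)
Definition insert_digits (a : nat -> nat) i :=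
  if sigma i is Some d then d else a (kept i).

Lemma kept_le m : kept m <= m.
Proof. by elim: m => //= m IH; case: eqP => _ /=; lia. Qed.

End insertion.

Section insertion_denominators.
Variables (sigma : nat -> option nat) (C : nat).
Hypothesis sigma_bnd : forall i d, sigma i = Some d -> (0 < d < C)%N.

Local Notation kept := (kept sigma).
Local Notation insert := (insert_digits sigma).

Lemma insert_digits_gt0 a : positive_digits a -> positive_digits (insert a).
Proof.
move=> a0 [//|i] _; rewrite /insert_digits /=.
case E: (sigma i.+1) => [d|]; first by have /andP[] := sigma_bnd E.
by apply: a0; rewrite addn1.
Qed.

(** Copied digits preserve the comparison of denominators; each of the
    m - kept m inserted ones costs a factor at most C. *)
Lemma dominated_insert_digits a m : positive_digits a ->
  dominated (C ^ (m - kept m))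
    (denominators (insert a) m) (denominators a (kept m)).
Proof.
move=> a0; elim: m => [|m IH] //=.
have ia0 := insert_digits_gt0 a0; have [pm _] := den_monotone m ia0.
have km := kept_le sigma m; rewrite [insert a m.+1]/insert_digits /=.
case E: (sigma m.+1) => [d|] /=; last first.
  by rewrite addn1 subSS; apply: dominated_common => //; exact: a0.
rewrite addn0 subSn // expnS; have /andP[d0 dC] := sigma_bnd E.
have [h1 h2] := @dominated_insert _ _ _ d pm IH.
by split; [apply: leq_trans h1 _|apply: leq_trans h2 _];
  rewrite leq_mul2r leq_mul2r dC !orbT.
Qed.

(** The inserted digits are the same for a and b, so only copied positions can
    distinguish them. *)
Lemma insert_digits_agree a b m :
  (forall i, (0 < i <= m)%N -> insert a i = insert b i) ->
  forall j, (0 < j <= kept m)%N -> a j = b j.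
Proof.
elim: m => [|m IH] ab j /=; first by lia.
have IH' := IH (fun i im => ab i ltac:(lia)).
have := ab m.+1 ltac:(lia); rewrite /insert_digits /=.
case E: (sigma m.+1) => [d|] /=; first by rewrite addn0 => _; exact: IH'.
move=> abm jm; have [jk|jk] := leqP j (kept m); first by apply: IH'; lia.
by rewrite (_ : j = (kept m + 1)%N) //; lia.
Qed.

End insertion_denominators.

(** * Longest runs and the schedule of insertions *)

Section run_length.
Local Open Scope nat_scope.
Implicit Types (c : nat -> nat) (n d r : nat).

(** The formula of [longest_run], for a sequence of digits instead of a real
    number. *)
Definition run_length n c d :=
  \max_(0 <= j < n) \sum_(1 <= k < (n - j).+1)
     \prod_(1 <= i < k.+1) (c (j + i) == d).

Lemma run_prod c d j k :
  \prod_(1 <= i < k.+1) (c (j + i) == d) =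
  (all (fun i => c (j + i) == d) (iota 1 k)) :> nat.
Proof.
rewrite /index_iota subn1 /=; elim: (iota 1 k) => [|i s IH].
  by rewrite big_nil.
by rewrite big_cons IH /= mulnb.
Qed.

Lemma run_length_le n c d r :
  (forall j, j + r < n -> exists2 i, 0 < i <= r.+1 & c (j + i) != d) ->
  run_length n c d <= r.
Proof.
move=> H; rewrite /run_length big_mkord; apply/bigmax_leqP => j _.
have [rn|nr] := ltnP (j + r) n; last first.
  apply: leq_trans (_ : \sum_(1 <= k < (n - j).+1) 1 <= _).
    by apply: leq_sum => k _; rewrite run_prod leq_b1.
  by rewrite sum_nat_const_nat muln1; lia.
have [i /andP[i0 ir] ci] := H j rn.
rewrite (@big_cat_nat _ _ _ r.+1) //=; last by lia.
rewrite [X in _ + X]big_nat_cond [X in _ + X]big1 ?addn0 => [|k]; last first.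
  rewrite andbT => /andP[rk kn]; rewrite run_prod.
  case: allP => // /(_ i); rewrite mem_iota => /(_ ltac:(lia)).
  by rewrite (negbTE ci).
apply: leq_trans (_ : \sum_(1 <= k < r.+1) 1 <= _).
  by apply: leq_sum => k _; rewrite run_prod leq_b1.
by rewrite sum_nat_const_nat muln1; lia.
Qed.

Lemma run_length_ge n c d j r : j + r <= n ->
  (forall i, 0 < i <= r -> c (j + i) = d) -> r <= run_length n c d.
Proof.
case: r => // r jr H; have jn : j < n by lia.
rewrite /run_length big_mkord.
apply: leq_trans (leq_bigmax (Ordinal jn)) => /=.
rewrite (@big_cat_nat _ _ _ r.+2) //=; last by lia.
apply: leq_trans (leq_addr _ _).
apply: leq_trans (_ : \sum_(1 <= k < r.+2) 1 <= _).
  by rewrite sum_nat_const_nat muln1; lia.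
rewrite big_nat_cond [leqRHS]big_nat_cond; apply: leq_sum => k.
rewrite andbT => /andP[k1 kr]; rewrite run_prod.
case: allP => // -[] i; rewrite mem_iota => ik.
by apply/eqP; apply: H; lia.
Qed.

End run_length.

Section schedule.
Local Open Scope nat_scope.
Variables (f : nat -> nat) (M lambda : nat).
Hypotheses (f_gt0 : forall n, 0 < n -> 0 < f n)
  (f_mono : forall m n, 0 < m -> m <= n -> f m <= f n)
  (M_gt1 : 1 < M).

(** The k-th planted run fills the f (s k) positions after s k. Proportional
    gaps M * f (s k) make the planted positions sparse, while f hardly changes
    from one start to the next. Every s k is a multiple of M outside the
    planted runs, so that the schedule puts a digit other than lambda there. *)
Fixpoint run_start k :=
  if k is k'.+1 then run_start k' + M * f (run_start k') else M.

Local Notation s := run_start.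

Lemma run_start_gt0 k : 0 < s k.
Proof. by elim: k => //= [|k IH]; lia. Qed.

Lemma run_start_gap k : s k + f (s k) < s k.+1.
Proof. by have := f_gt0 (run_start_gt0 k) => /=; nia. Qed.

Lemma run_start_mono : {homo s : i j / i <= j}.
Proof.
by apply: homo_leq => // [y x z|k]; [exact: leq_trans|rewrite /= leq_addr].
Qed.

Lemma run_start_gtn k : k < s k.
Proof.
elim: k => [|k IH]; first exact: run_start_gt0.
by have := run_start_gap k; lia.
Qed.

Lemma run_start_dvd k : M %| s k.
Proof. by elim: k => //= k IH; rewrite dvdn_add // dvdn_mulr. Qed.

Lemma run_start_floor m : M <= m -> exists k, s k <= m < s k.+1.
Proof.
move=> Mm; have ex : exists k, m < s k by exists m; exact: run_start_gtn.
case: (ex_minnP ex) => -[|k] mk kmin; first by move: mk => /=; lia.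
exists k; rewrite mk andbT leqNgt; apply/negP => /kmin; lia.
Qed.

Definition planted i := [exists k : 'I_i, s k < i <= s k + f (s k)].

Lemma plantedP i : reflect (exists k, s k < i <= s k + f (s k)) (planted i).
Proof.
apply: (iffP existsP) => [[k ?]|[k ik]]; first by exists k.
have ki : k < i by have := run_start_gtn k; lia.
by exists (Ordinal ki).
Qed.

Lemma not_planted_gap k i : s k + f (s k) < i <= s k.+1 -> ~~ planted i.
Proof.
move=> ik; apply/plantedP => -[j ij]; have [jk|kj] := leqP j k.
  have : s j + f (s j) <= s k + f (s k).
    by rewrite leq_add ?run_start_mono // f_mono ?run_start_gt0 ?run_start_mono.
  by lia.
by have := run_start_mono kj; lia.
Qed.

Lemma not_planted_start i : i <= M -> ~~ planted i.
Proof.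
move=> iM; apply/plantedP => -[j ij].
by have := run_start_mono (leq0n j) => /=; lia.
Qed.

(** The digits lambda.+1 are barriers: outside the planted runs, no M
    consecutive positions are free of them. *)
Definition schedule i :=
  if planted i then Some lambda
  else if M %| i then Some lambda.+1 else None.

Variable a : nat -> nat.
Let c := insert_digits schedule a.

(** It suffices to find a barrier among the f n + M + 1 positions that follow j.
    With s k <= j < s k.+1, either s k.+1 is among them, or the positions from
    j + f n + 1 to j + f n + M lie between the end of the k-th planted run and
    s k.+1, and one of them is a multiple of M. *)
Lemma run_length_schedule_le n : 0 < n -> run_length n c lambda <= f n + M.
Proof.
move=> n0; apply: run_length_le => j jn.
suff [t tj /andP[tM tP]] : exists2 t, j < t <= j + (f n + M).+1 &
    (M %| t) && ~~ planted t.
  exists (t - j); first by lia.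
  rewrite subnKC; last lia.
  rewrite /c /insert_digits /schedule (negbTE tP) tM.
  by apply/eqP; lia.
have [jM|Mj] := ltnP j M.
  by exists M; [lia|rewrite dvdnn not_planted_start].
have [k kj] := run_start_floor Mj.
have [ks|sk] := leqP (s k.+1) (j + (f n + M).+1).
  exists (s k.+1); first by lia.
  by rewrite run_start_dvd (@not_planted_gap k) // run_start_gap leqnn.
have fk : f (s k) <= f n by rewrite f_mono ?run_start_gt0 //; lia.
have tb : (j + f n) < ((j + f n) %/ M).+1 * M <= j + f n + M.
  have := divn_eq (j + f n) M; have := @ltn_pmod (j + f n) M (ltac:(lia)).
  move: (_ %/ _) (_ %% _) => q r rM e; rewrite mulSn; lia.
exists (((j + f n) %/ M).+1 * M); first by lia.
rewrite dvdn_mull //=; apply: (@not_planted_gap k); lia.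
Qed.

Lemma run_length_schedule_ge n k : s k + f (s k) <= n ->
  f (s k) <= run_length n c lambda.
Proof.
move=> kn; apply: (run_length_ge kn) => i ik.
rewrite /c /insert_digits /schedule (_ : planted _) //.
by apply/plantedP; exists k; lia.
Qed.

Definition planted_count m := \sum_(1 <= i < m.+1) planted i.

Lemma planted_count_step k m : s k <= m <= s k.+1 ->
  planted_count m <= planted_count (s k) + f (s k).
Proof.
move=> km; rewrite /planted_count (@big_cat_nat _ _ _ (s k).+1) //=; last lia.
rewrite leq_add2l.
have [mf|fm] := leqP m (s k + f (s k)).
  apply: leq_trans (_ : \sum_((s k).+1 <= i < m.+1) 1 <= _).
    by apply: leq_sum => i _; exact: leq_b1.
  by rewrite sum_nat_const_nat; lia.
rewrite (@big_cat_nat _ _ _ (s k + f (s k)).+1) //=; [|lia..].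
rewrite [X in _ + X]big_nat_cond [X in _ + X]big1 => [|i]; last first.
  by rewrite andbT => ik; rewrite (negbTE (@not_planted_gap k i _)) //; lia.
apply: leq_trans (_ : \sum_((s k).+1 <= i < (s k + f (s k)).+1) 1 <= _).
  by rewrite addn0; apply: leq_sum => i _; exact: leq_b1.
by rewrite sum_nat_const_nat; lia.
Qed.

Lemma planted_count_start m : m <= M -> planted_count m = 0.
Proof.
move=> mM; rewrite /planted_count big_nat_cond big1 // => i.
by rewrite andbT => im; rewrite (negbTE (not_planted_start _)) //; lia.
Qed.

(** The k-th block, from s k to s k.+1, has length M * f (s k) and contains
    f (s k) planted positions. *)
Lemma planted_count_run_start k : M * planted_count (s k) <= s k.
Proof.
elim: k => [|k IH]; first by rewrite planted_count_start // muln0.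
apply: leq_trans (_ : M * (planted_count (s k) + f (s k)) <= _).
  by rewrite leq_mul2l planted_count_step ?orbT // leqnn run_start_mono.
by rewrite mulnDr /= leq_add2r.
Qed.

Lemma kept_schedule m :
  m <= kept schedule m + planted_count m + m %/ M.
Proof.
elim: m => // m IH; rewrite /= /planted_count big_nat_recr //=.
rewrite -/(planted_count m) divnS; last by lia.
have -> : (schedule m.+1 == None) = ~~ planted m.+1 && ~~ (M %| m.+1).
  by rewrite /schedule; case: planted; case: (_ %| _).
by case: planted; case: (_ %| _) => /=; lia.
Qed.

Hypothesis f_slow : exists N, forall n, N <= n -> f (n + M * f n) <= 2 * f n.

(** For large k, M * f (s k.+1) <= 2 * M * f (s k) <= 2 * s k.+1 by slow growth
    of f and the definition of s; the constant takes care of small k. *)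
Lemma run_start_slow : exists c0, forall k, M * f (s k) <= 2 * s k + c0.
Proof.
have [N fN] := f_slow; exists (M * f (s N)) => k.
have [kN|Nk] := leqP k N.
  rewrite (leq_trans _ (leq_addl _ _)) // leq_mul2l.
  by rewrite f_mono ?run_start_gt0 ?orbT // run_start_mono.
case: k Nk => // k Nk; have Ns : N <= s k.
  by rewrite -ltnS (leq_trans Nk) // ltnW // ltnS run_start_gtn.
have := fN (s k) Ns => /=.
move: (s k) (f (s k)) (f (s k + _)) => u v w; nia.
Qed.

(** Up to m there are m %/ M multiples of M, at most s k / M planted positions
    in the complete blocks, and at most f (s k) in the last one, where
    M * f (s k) <= 2 * s k + c0 by [run_start_slow]. *)
Lemma inserted_count : exists c0, forall m,
  M * (m - kept schedule m) <= 4 * m + c0.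
Proof.
have [c0 cP] := run_start_slow; exists c0 => m.
have divM : M * (m %/ M) <= m by rewrite mulnC leq_divM.
suff h : M * planted_count m <= 3 * m + c0.
  have := kept_schedule m; nia.
have [mM|Mm] := leqP m M; first by rewrite planted_count_start // muln0.
have [k kP] := run_start_floor (ltnW Mm).
have := @planted_count_step k m; have := planted_count_run_start k.
have := cP k; case/andP: kP => k1 k2.
move=> h1 h2 /(_ ltac:(lia)) h3.
apply: leq_trans (_ : M * (planted_count (s k) + f (s k)) <= _).
  by rewrite leq_mul2l h3 orbT.
by lia.
Qed.

End schedule.

Lemma schedule_digit_bound f M lambda : (0 < lambda)%N ->
  forall i d, schedule f M lambda i = Some d -> (0 < d < lambda.+2)%N.
Proof.
move=> l0 i d; rewrite /schedule; case: ifP => _; first by case=> <-; lia.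
by case: ifP => // _ [<-]; lia.
Qed.

(** * Hoelder continuity of the removal of the inserted digits *)

Section gauss_digits.
Context (R : realType).
Implicit Types x : R.

Definition gauss_digits x n : nat := Num.truncn (iter n.-1 (@gauss R) x)^-1.

Lemma gauss_digits_gt0 x : 0 <= x < 1 -> irrational x ->
  positive_digits (gauss_digits x).
Proof.
move=> x01 xI n _; have [_ /andP[y0 y1]] := gauss_iter n.-1 x01 xI.
by rewrite /gauss_digits truncn_gt0 invf_ge1 // ltW.
Qed.

Lemma gauss_digits_orbit x n : 0 <= x < 1 -> irrational x ->
  orbit_upto (gauss_digits x) n (fun j => iter j (@gauss R) x).
Proof.
move=> x01 xI; split=> [j|j _].
  by have [_ /andP[/ltW -> /ltW ->]] := gauss_iter j x01 xI.
by rewrite /gauss_digits /= {2}/gauss addrC subrK invrK.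
Qed.

Lemma gauss_digits_le x n (b : R) : 0 <= x < 1 -> irrational x -> 0 < b ->
  b^-1 < iter n (@gauss R) x -> (gauss_digits x n.+1)%:R <= b.
Proof.
move=> x01 xI b0 bx; rewrite /gauss_digits /=.
have [_ /andP[y0 _]] := gauss_iter n x01 xI.
have yV : 0 <= (iter n (@gauss R) x)^-1 by rewrite invr_ge0 ltW.
have /andP[h _] := truncn_itv yV; apply: le_trans h _.
by rewrite -[leRHS]invrK lef_pV2 ?posrE ?invr_gt0 // ltW.
Qed.

End gauss_digits.

Section hoelder.
Context (R : realType).
(* rho is the growth rate granted to the digits and, through C_rho, to the cost
   of the insertions; rho10 makes the total loss, rho ^ (5 * m), comparable to
   the gain from the exponent 1 - s. *)
Variables (sigma : nat -> option nat) (C M c0 : nat) (K rho s : R).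
Hypothesis sigma_bnd : forall i d, sigma i = Some d -> (0 < d < C)%N.
Hypothesis C_gt0 : (0 < C)%N.
Hypothesis M_ge8 : (8 <= M)%N.
Hypothesis inserted : forall m, (M * (m - kept sigma m) <= 4 * m + c0)%N.
Hypothesis K_ge1 : 1 <= K.
Hypothesis rho_ge1 : 1 <= rho.
Hypothesis C_rho : (C ^ 4)%:R <= rho ^+ M.
Hypothesis s01 : 0 <= s < 1.
Hypothesis rho10 : rho ^+ 10 = 2 `^ (1 - s).

Local Notation kept := (kept sigma).
Local Notation S := (bounded_digits_set (fun n => K * rho ^+ n)).

Definition insert_map (x : R) : R :=
  cfrac_tail R (insert_digits sigma (gauss_digits x)) 0.

Let K_gt0 : 0 < K := lt_le_trans ltr01 K_ge1.
Let rho_gt0 : 0 < rho := lt_le_trans ltr01 rho_ge1.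

Let le_kept m : (m <= 2 * kept m + 2 * c0)%N.
Proof.
have := inserted m; have := kept_le sigma m.
move: (kept m) => k; nia.
Qed.

Let kept_ge n : (n <= kept (2 * n + 2 * c0))%N.
Proof. by have := le_kept (2 * n + 2 * c0); lia. Qed.

(** Compare M-th powers: M * (m - kept m) <= 4 * m + c0 and C ^ 4 <= rho ^ M. *)
Lemma insertion_cost m : (C ^ (m - kept m))%:R <= rho ^+ m * (C ^ c0)%:R.
Proof.
have M0 : (0 < M)%N by lia.
have rho0 : 0 <= rho := ltW rho_gt0.
rewrite -(@ler_pXn2r _ M) ?nnegrE ?mulr_ge0 ?ler0n ?exprn_ge0 //.
rewrite exprMn -exprM [(m * M)%N]mulnC exprM -natrX -expnM.
apply: le_trans (_ : (C ^ (4 * m + c0))%:R <= _).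
  by rewrite ler_nat leq_pexp2l // mulnC inserted.
rewrite expnD natrM; apply: ler_pM; rewrite ?ler0n //.
  by rewrite expnM natrX lerXn2r ?nnegrE ?exprn_ge0.
by rewrite -natrX ler_nat -expnM leq_pexp2l // leq_pmulr.
Qed.

Let gauss_bound x i : S x -> (gauss_digits x i.+1)%:R <= K * rho ^+ i.
Proof.
move=> [x01 xI xB]; apply: gauss_digits_le => //.
by rewrite mulr_gt0 ?exprn_gt0.
Qed.

(** The range i <= m + 3 is the one in which [cfrac_tail_dist_gap] needs bounded
    digits. *)
Lemma insert_digits_bound x m i : S x -> (0 < i <= m.+3)%N ->
  (insert_digits sigma (gauss_digits x) i)%:R + 1 <=
    (C%:R + K * rho ^+ 3 + 1) * rho ^+ m.
Proof.
move=> xS im; have rho1 n : 1 <= rho ^+ n by exact: exprn_ege1.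
have Cm : C%:R + 1 <= (C%:R + 1) * rho ^+ m.
  by rewrite ler_peMr // addr_ge0.
rewrite /insert_digits; case E: (sigma i) => [d|].
  have /andP[_ dC] := sigma_bnd E.
  have : d%:R <= C%:R :> R by rewrite ler_nat ltnW.
  have : 0 <= K * rho ^+ 3 * rho ^+ m.
    by rewrite !mulr_ge0 ?exprn_ge0 // ltW.
  rewrite [X in _ -> _ -> _ <= X](_ : _ =
    (C%:R + 1) * rho ^+ m + K * rho ^+ 3 * rho ^+ m); last by ring.
  by move=> ? ?; lra.
have [j ij] : exists j, kept i = j.+1.
  case: i im E => [|i] im //= E; rewrite E /=; exists (kept i); lia.
have jm : (j <= m + 3)%N by have := kept_le sigma i; lia.
rewrite ij; apply: le_trans (_ : K * rho ^+ (m + 3) + 1 <= _).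
  rewrite lerD2r (le_trans (gauss_bound _ xS)) // ler_wpM2l ?(ltW K_gt0) //.
  by rewrite ler_weXn2l.
rewrite exprD [leRHS](_ : _ =
  K * (rho ^+ m * rho ^+ 3) + (C%:R + 1) * rho ^+ m); last by ring.
rewrite lerD2l (le_trans _ Cm) //.
have C0 : 0 <= C%:R :> R by [].
lra.
Qed.

(** If all digits agree after insertion, then x and y agree in arbitrarily many
    digits, because at least about half of the positions are copied. *)
Lemma insert_map_inj x y : S x -> S y ->
  (forall i, (0 < i)%N -> insert_digits sigma (gauss_digits x) i =
                          insert_digits sigma (gauss_digits y) i) -> x = y.
Proof.
move=> [x01 xI _] [y01 yI _] xy.
apply/eqP; rewrite -subr_eq0 -normr_le0; apply/ler_addgt0Pl => e e0.
have /cvgrPdist_lt /(_ e e0)[n _ ne] := @cvg_geometric_half R.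
have := ne n (leqnn n); rewrite sub0r normrN ger0_norm; last first.
  by rewrite mulr_ge0 // exprn_ge0 // invr_ge0.
move=> lte; rewrite addr0; apply: le_trans (ltW lte).
have gx0 := gauss_digits_gt0 x01 xI.
suff oy : orbit_upto (gauss_digits x) n (fun j => iter j (@gauss R) y).
  exact: (orbit_contract gx0 (gauss_digits_orbit n x01 xI) oy).
apply: (eq_orbit_upto _ (gauss_digits_orbit n y01 yI)) => j jn.
have agree := @insert_digits_agree sigma (gauss_digits x) (gauss_digits y)
  (2 * n + 2 * c0) (fun i im => xy i (proj1 (andP im))).
by rewrite agree //; case/andP: jn => -> jn; exact: leq_trans jn (kept_ge n).
Qed.

(** Let m + 1 be the first position at which the expansions of the images
    differ, and q the denominator of x and y after their kept m common digits.
    The denominator of the images after m digits is at most rho ^ m * q up to a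
    constant, which contributes rho ^ (2 * m), and the different digits at
    m + 1, of size rho ^ m, contribute rho ^ (3 * m). *)
Lemma insert_map_distance : exists2 A : R, 1 <= A &
  forall x y, S x -> S y -> x != y -> exists (q m : nat),
  [/\ (0 < q)%N, `|x - y| <= (q%:R ^+ 2)^-1,
      (2 ^ m <= 2 ^ (2 * c0) * (2 * q ^ 2) ^ 2)%N &
      (A * rho ^+ (5 * m) * q%:R ^+ 2)^-1 <= `|insert_map x - insert_map y|].
Proof.
pose K' : R := C%:R + K * rho ^+ 3 + 1.
have rho1 n : 1 <= rho ^+ n by exact: exprn_ege1.
have K'1 : 1 <= K'.
  have C0 : 0 <= C%:R :> R by []; have K0 : 0 <= K * rho ^+ 3.
    by rewrite mulr_ge0 ?exprn_ge0 // ltW.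
  by rewrite /K'; lra.
pose Cc : R := (maxn 1 (C ^ c0))%:R.
have Cc1 : 1 <= Cc by rewrite ler1n leq_maxl.
exists (8 * K' ^+ 3 * Cc ^+ 2).
  have k3 : 1 <= K' ^+ 3 by exact: exprn_ege1.
  have c2 : 1 <= Cc ^+ 2 by exact: exprn_ege1.
  by rewrite -[leLHS]mulr1 ler_pM //; lra.
move=> x y xS yS xy.
set a := gauss_digits x; set b := gauss_digits y.
pose ia := insert_digits sigma a; pose ib := insert_digits sigma b.
have ex : exists m, ia m.+1 != ib m.+1.
  apply: contrapT => /forallNP h; move/eqP: xy; apply.
  apply: insert_map_inj => //.
  by move=> [//|i] _; apply/eqP/negPn/negP; exact: h.
case: (ex_minnP ex) => m dm mmin.
have agree i : (0 < i <= m)%N -> ia i = ib i.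
  case: i => // i im; apply/eqP; apply: contraT => /mmin.
  by rewrite leqNgt; case/andP: im => _ ->.
have agree0 := insert_digits_agree agree.
have [x01 xI _] := xS; have [y01 yI _] := yS.
have a0 : positive_digits a := gauss_digits_gt0 x01 xI.
have b0 : positive_digits b := gauss_digits_gt0 y01 yI.
have ia0 : positive_digits ia := insert_digits_gt0 sigma_bnd a0.
have ib0 : positive_digits ib := insert_digits_gt0 sigma_bnd b0.
set n := kept m in agree0.
have [_ q0] := den_monotone n a0.
have oy : orbit_upto a n (fun j => iter j (@gauss R) y).
  apply: (eq_orbit_upto _ (gauss_digits_orbit n y01 yI)) => j jn.
  by rewrite agree0.
have q2 : 0 < (den a n)%:R ^+ 2 :> R by rewrite exprn_gt0 // ltr0n.
exists (den a n), m; split => //.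
- rewrite -[leRHS]mul1r ler_pdivlMr //.
  apply: le_trans (orbit_distance_le a0 (gauss_digits_orbit n x01 xI) oy) _.
  have [_ /andP[x0 x1]] := gauss_iter n x01 xI.
  have [_ /andP[y0 y1]] := gauss_iter n y01 yI.
  by rewrite ler_norml; lra.
- apply: leq_trans (_ : 2 ^ (2 * c0 + n * 2) <= _)%N.
    by rewrite leq_exp2l // addnC [(n * 2)%N]mulnC.
  rewrite expnD leq_mul2l [in (2 ^ (n * 2))%N]expnM.
  by rewrite leq_exp2r ?den_growth ?orbT.
have digs i : (0 < i <= m.+3)%N ->
    (ia i)%:R + 1 <= K' * rho ^+ m /\ (ib i)%:R + 1 <= K' * rho ^+ m.
  by move=> im; split; apply: insert_digits_bound.
have gap := cfrac_tail_dist_gap ia0 ib0 dm digs.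
have P := orbit_distance_ge ia0 (cfrac_tail_orbit R m ia0)
  (eq_orbit_upto (fun j jm => esym (agree j jm)) (cfrac_tail_orbit R m ib0)).
have [P0 _] := dominated_insert_digits sigma_bnd m a0.
have Pq : (den ia m)%:R <= rho ^+ m * Cc * (den a n)%:R.
  apply: le_trans (_ : (C ^ (m - n))%:R * (den a n)%:R <= _).
    by rewrite -natrM ler_nat.
  rewrite ler_wpM2r // (le_trans (insertion_cost m)) //.
  by rewrite ler_wpM2l ?(le_trans ler01) // ler_nat leq_maxr.
have [_ P1] := den_monotone m ia0.
have d1 := le_trans gap P.
have d2 : (2 * (K' * rho ^+ m) ^+ 3)^-1 <= `|insert_map x - insert_map y| *
    (4 * (rho ^+ m * Cc * (den a n)%:R) ^+ 2).
  apply: le_trans d1 _; rewrite ler_wpM2l // ler_wpM2l //.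
  by rewrite lerXn2r ?nnegrE ?ler0n // (le_trans (ler0n _ _) Pq).
set u := 4 * _ in d2.
have u0 : 0 < u.
  have Cc0 : 0 < Cc := lt_le_trans ltr01 Cc1.
  have q0' : 0 < (den a n)%:R :> R by rewrite ltr0n.
  by rewrite /u mulr_gt0 // exprn_gt0 // mulr_gt0 // mulr_gt0 // exprn_gt0.
rewrite -ler_pdivrMr // in d2.
apply: le_trans d2; rewrite -invfM /u le_eqVlt; apply/orP; left; apply/eqP.
congr (_^-1); rewrite (_ : (5 * m = m * 5)%N) ?exprM; last by rewrite mulnC.
by ring.
Qed.
(** With Q = q ^ 2, the bound 2 ^ m <= const * Q ^ 2 and rho ^ 10 = 2 `^ (1 - s)
    give rho ^ (5 * m) <= const * Q `^ (1 - s). Hence the distance 1 / Q of the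
    points is at most a constant times rho ^- (5 * m) * Q `^ (- s), and so at
    most a constant times (rho ^- (5 * m) / Q) `^ s. *)
Lemma insert_map_hoelder : exists2 B : R, 0 < B &
  forall x y, S x -> S y -> `|x - y| <= B * `|insert_map x - insert_map y| `^ s.
Proof.
have [A A1 dist] := insert_map_distance.
have /andP[s0 s1] := s01.
have A0 : 0 < A := lt_le_trans ltr01 A1.
have B0 : 0 < 2 ^+ c0.+1 * A by rewrite mulr_gt0 ?exprn_gt0.
exists (2 ^+ c0.+1 * A) => // x y xS yS.
have [<-|xy] := eqVneq x y.
  by rewrite subrr normr0 mulr_ge0 ?powR_ge0 // ltW.
have [q [m [q0 xyq mq gxy]]] := dist x y xS yS xy.
set t := `|insert_map x - insert_map y| in gxy *.
have t0 : 0 <= t := normr_ge0 _.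
have Q0 : 0 < q%:R ^+ 2 :> R by rewrite exprn_gt0 // ltr0n.
set Q := q%:R ^+ 2 in xyq gxy Q0.
set r := rho ^+ (5 * m) in gxy.
have r1 : 1 <= r by exact: exprn_ege1.
have r0 : 0 < r := lt_le_trans ltr01 r1.
have E1 : 1 <= A * r by rewrite -[leLHS]mulr1 ler_pM.
have rQ : r <= 2 ^+ c0.+1 * Q `^ (1 - s).
  have ss : 0 <= 1 - s by rewrite subr_ge0 ltW.
  rewrite -(@ler_pXn2r _ 2) ?nnegrE ?mulr_ge0 ?exprn_ge0 ?powR_ge0 //
    ?(ltW r0) ?(ltW rho_gt0) //.
  rewrite /r -exprM mulnAC [rho ^+ _]exprM rho10.
  rewrite -powR_mulrn ?powR_ge0 // powRAC powR_mulrn //.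
  apply: le_trans (_ : (2 ^+ (2 * c0) * (2 * Q) ^+ 2) `^ (1 - s) <= _).
    apply: ge0_ler_powR => //;
      rewrite ?nnegrE ?mulr_ge0 ?exprn_ge0 ?mulr_ge0 ?(ltW Q0) //.
    by rewrite /Q -!natrX -!natrM -natrX -natrM ler_nat.
  rewrite (_ : _ * _ = (2 ^+ c0.+1) ^+ 2 * Q ^+ 2); last first.
    by rewrite [(2 * c0)%N]mulnC exprM [2 ^+ c0.+1]exprS; ring.
  rewrite powRM ?exprn_ge0 ?(ltW Q0) // [leRHS]exprMn.
  apply: ler_pM; rewrite ?powR_ge0 //.
    by rewrite ler1_powR ?exprn_ege1 ?ler1n // gerBl.
  by rewrite -[Q ^+ 2]powR_mulrn ?(ltW Q0) // powRAC powR_mulrn ?powR_ge0.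
have tQ : (A * r)^-1 * Q^-1 `^ s <= t `^ s.
  apply: le_trans (_ : ((A * r * Q)^-1) `^ s <= _); last first.
    by apply: ge0_ler_powR;
      rewrite ?nnegrE ?invr_ge0 ?mulr_ge0 ?(ltW A0) ?(ltW r0) ?(ltW Q0).
  rewrite [(A * r * Q)^-1]invfM powRM ?invr_ge0 ?mulr_ge0
    ?(ltW Q0) ?(ltW A0) ?(ltW r0) //.
  rewrite ler_wpM2r ?powR_ge0 // ger1_powR ?(ltW s1) //.
  by rewrite invr_gt0 invf_le1 ?(lt_le_trans ltr01 E1) // E1.
apply: le_trans xyq _.
apply: le_trans (_ : 2 ^+ c0.+1 * A * ((A * r)^-1 * Q^-1 `^ s) <= _).
  rewrite [leRHS](_ : _ = 2 ^+ c0.+1 * r^-1 * Q^-1 `^ s); last first.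
    by field; rewrite !gt_eqF.
  have QE : Q^-1 = Q^-1 `^ (1 - s) * Q^-1 `^ s.
    rewrite -powRD ?subrK ?powRr1 ?invr_ge0 ?(ltW Q0) //.
    by rewrite invr_eq0 gt_eqF ?implybT.
  rewrite {1}QE ler_wpM2r ?powR_ge0 //.
  rewrite -[Q^-1]powR_inv1 ?(ltW Q0) // -powRrM mulN1r powRN.
  rewrite ler_pdivlMr // mulrC ler_pdivrMr ?powR_gt0 //.
by rewrite ler_wpM2l // ltW.
Qed.

End hoelder.

(** * Hausdorff measures *)

Section hausdorff.
Context (R : realType).
Implicit Types (A S : set R) (s : R).

Lemma diam_ge0 A : (0 <= diam A)%E.
Proof. by apply: ereal_sup_ubound; left. Qed.

Lemma diam_le A (c : R) : 0 <= c ->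
  (forall x y, A x -> A y -> `|x - y| <= c) -> (diam A <= c%:E)%E.
Proof.
move=> c0 Ac; apply: ge_ereal_sup => _ [->|[[x y] [/= xA yA] <-]].
  by rewrite lee_fin.
by rewrite lee_fin Ac.
Qed.

Lemma diam_ge A x y : A x -> A y -> (`|x - y|%:E <= diam A)%E.
Proof. by move=> xA yA; apply: ereal_sup_ubound; right; exists (x, y). Qed.

Lemma diam_fin A (c : R) : (diam A <= c%:E)%E ->
  exists2 d : R, 0 <= d <= c & diam A = d%:E.
Proof.
have := diam_ge0 A; case: (diam A) => [d| |] //.
by rewrite !lee_fin => d0 dc; exists d; rewrite // d0.
Qed.

Lemma diam_pow_ge0 s A : (0 <= diam_pow s A)%E.
Proof. by rewrite /diam_pow; case: eqP => // _; exact: poweR_ge0. Qed.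

Lemma diam_pow_le s A (c : R) : 0 <= s -> (diam A <= c%:E)%E ->
  (diam_pow s A <= (c `^ s)%:E)%E.
Proof.
move=> s0 Ac; rewrite /diam_pow; case: eqP => _.
  by rewrite lee_fin powR_ge0.
have [d /andP[d0 dc] ->] := diam_fin Ac.
rewrite poweR_EFin lee_fin ge0_ler_powR // nnegrE //.
exact: le_trans d0 dc.
Qed.

Lemma hausdorff_premeasure_ge0 s delta A :
  (0 <= hausdorff_premeasure s delta A)%E.
Proof.
apply: le_ereal_inf_tmp => _ [U _ <-].
by apply: nneseries_ge0 => n _ _; exact: diam_pow_ge0.
Qed.

(** The cover by N intervals of length 1 / N has s-sum N `^ (1 - s), which tends
    to 0. *)
Lemma hausdorff_measure_unit_itv s A : 1 < s ->
  (forall x, A x -> 0 <= x < 1) -> hausdorff_measure s A = 0%E.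
Proof.
move=> s1 A01; have s0 : 0 <= s by lra.
have s10 : 0 < s - 1 by lra.
apply/eqP; rewrite eq_le; apply/andP; split; last first.
  apply: le_trans (hausdorff_premeasure_ge0 s 1 A) _.
  by apply: ereal_sup_ubound; exists 1 => //=.
apply: ge_ereal_sup => _ [delta /= d0 <-].
apply/lee_addgt0Pr => e e0; rewrite add0e.
(* h meets the bound delta, and its (s - 1)-th power is at most e. *)
pose h := Num.min delta (e `^ (s - 1)^-1).
have h0 : 0 < h by rewrite lt_min d0 powR_gt0.
pose N := (Num.truncn h^-1).+1.
have N0 : 0 < N%:R :> R by rewrite ltr0n.
have Nh : N%:R^-1 <= h.
  rewrite -[leRHS]invrK lef_pV2 ?posrE ?invr_gt0 // ltW //.
  have hV : 0 <= h^-1 by rewrite invr_ge0 ltW.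
  by have /andP[] := truncn_itv hV.
pose U k : set R := if (k < N)%N then
  [set x | k%:R / N%:R <= x < k.+1%:R / N%:R] else set0.
have Ud k : (diam (U k) <= (N%:R^-1)%:E)%E.
  apply: diam_le => [|x y]; first by rewrite invr_ge0 ltW.
  rewrite /U; case: ifP => // _ /= /andP[x1 x2] /andP[y1 y2].
  have e1 : k.+1%:R / N%:R = k%:R / N%:R + N%:R^-1 :> R.
    by rewrite -natr1 mulrDl mul1r.
  by rewrite e1 in x2 y2; rewrite ler_norml; lra.
apply: le_trans (_ : \sum_(0 <= k <oo) diam_pow s (U k) <= _)%E.
  apply: ereal_inf_lbound; exists U => //; split=> [x xA|k]; last first.
    by apply: le_trans (Ud k) _; rewrite lee_fin (le_trans Nh) // ge_min lexx.
  have /andP[x0 x1] := A01 x xA.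
  have xN : 0 <= x * N%:R by rewrite mulr_ge0 // ltW.
  have /andP[t1 t2] := truncn_itv xN.
  exists (Num.truncn (x * N%:R)) => //; rewrite /U ifT /=.
    by rewrite ler_pdivrMr // t1 ltr_pdivlMr // t2.
  by rewrite -(ltr_nat R) (le_lt_trans t1) // gtr_pMl.
apply: nneseries_le_bound => [n|n]; first exact: diam_pow_ge0.
have bnd m : (\sum_(0 <= k < m) diam_pow s (U k) <=
    (\sum_(0 <= k < m) if (k < N)%N then (N%:R^-1) `^ s else 0)%:E)%E.
  rewrite -sumEFin; apply: lee_sum => k _; rewrite [U]lock.
  case: ifP => kN; first by apply: diam_pow_le => //; rewrite -lock.
  by rewrite -lock /U kN /diam_pow eqxx.
apply: le_trans (bnd n) _; rewrite lee_fin.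
have NN : \sum_(0 <= k < N) (N%:R^-1) `^ s <= e.
  rewrite sumr_const_nat subn0 -[leLHS]mulr_natl.
  have -> : N%:R * N%:R^-1 `^ s = N%:R^-1 `^ (s - 1).
    rewrite -(@mulr_powRB1 _ N%:R^-1 s) ?invr_ge0 ?(ltW N0) //; last lra.
    by rewrite mulrA divff ?mul1r // gt_eqF.
  apply: le_trans (_ : h `^ (s - 1) <= _).
    by rewrite ge0_ler_powR ?nnegrE ?invr_ge0 // ltW.
  apply: le_trans (_ : (e `^ (s - 1)^-1) `^ (s - 1) <= _).
    rewrite ge0_ler_powR ?nnegrE ?powR_ge0 ?(ltW h0) ?(ltW s10) //.
    by rewrite ge_min lexx orbT.
  by rewrite -powRrM mulVf ?gt_eqF // powRr1 // ltW.
apply: le_trans NN.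
have [nN|Nn] := leqP n N.
  rewrite (big_cat_nat (n := n) _ nN) //= -[leLHS]addr0 lerD //; last first.
    by apply: sumr_ge0 => k _; exact: powR_ge0.
  by apply: ler_sum => k _; case: ifP => // _; exact: powR_ge0.
rewrite (big_cat_nat (n := N) _ (ltnW Nn)) //= -[leRHS]addr0 lerD //.
  by apply: ler_sum => k _; case: ifP => // _; exact: powR_ge0.
rewrite big_nat_cond big1 // => k; rewrite andbT => /andP[Nk _].
by rewrite ltnNge Nk.
Qed.

(** A cover U of A gives the cover of S by the preimages of the U k. If x lies
    in the k-th preimage, the whole preimage is within B * diam (U k) `^ s of
    x; so the measure of S is at most 2 * B times the s-sum of U. *)
Lemma hausdorff_null_hoelder_preimage S A (g : R -> R) (B s : R) :
  0 < B -> 0 <= s -> (forall x, S x -> A (g x)) ->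
  (forall x y, S x -> S y -> `|x - y| <= B * `|g x - g y| `^ s) ->
  hausdorff_measure s A = 0%E -> (lebesgue_measure S <= 0)%E.
Proof.
move=> B0 s0 SA gB HA; apply/lee_addgt0Pr => e e0; rewrite add0e.
have pre0 : (hausdorff_premeasure s 1 A <= 0)%E.
  by rewrite -HA; apply: ereal_sup_ubound; exists 1 => //=.
pose eta := e / (2 * B).
have B2 : 0 < 2 * B by rewrite mulr_gt0.
have eta0 : 0 < eta by rewrite divr_gt0.
have : (hausdorff_premeasure s 1 A < eta%:E)%E.
  by apply: le_lt_trans pre0 _; rewrite lte_fin.
case/ereal_inf_lt => _ [U [AU Ud] <-] sumU.
pose V k := S `&` g @^-1` U k.
have SV : S `<=` \bigcup_k V k.
  by move=> x xS; have [k _ xk] := AU _ (SA x xS); exists k.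
apply: le_trans (lebesgue_measure_le SV) _.
apply: le_trans (lebesgue_measure_subadditive V) _.
apply: le_trans (_ : \sum_(0 <= k <oo) (2 * B)%:E * diam_pow s (U k) <= _)%E.
  apply: lee_nneseries => [k _ _|k _]; first exact: measure_ge0.
  have [[x [xS /= xU]]|V0] := pselect (exists x, V k x); last first.
    rewrite (_ : V k = set0); last first.
      by apply/seteqP; split => // x xV; apply: V0; exists x.
    by rewrite measure0 mule_ge0 ?diam_pow_ge0 // lee_fin ltW.
  rewrite /diam_pow; case: eqP => [Uk|_]; first by rewrite Uk in xU.
  have [d /andP[d0 d1] dE] := diam_fin (Ud k).
  rewrite dE poweR_EFin -EFinM.
  pose r := B * d `^ s.
  have r0 : 0 <= r by rewrite mulr_ge0 ?powR_ge0 // ltW.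
  have VI : V k `<=` `[x - r, x + r]%classic.
    move=> y [yS /= yU]; rewrite in_itv /=.
    have gd : `|g y - g x| <= d.
      by rewrite -lee_fin -dE; exact: diam_ge.
    have : `|y - x| <= r.
      apply: le_trans (gB y x yS xS) _; apply: ler_wpM2l; first exact: ltW.
      by rewrite ge0_ler_powR // nnegrE.
    by rewrite ler_distl.
  apply: (le_trans (lebesgue_measure_le VI)).
  rewrite lebesgue_measure_itv /= lte_fin.
  case: ifP => _; rewrite -?EFinB lee_fin /r in r0 *; last first.
    by rewrite -mulrA mulr_ge0.
  by rewrite -mulrA -/r; lra.
rewrite nneseriesZl; last by move=> k _; exact: diam_pow_ge0.
have -> : e%:E = ((2 * B)%:E * eta%:E)%E.
  by rewrite -EFinM /eta mulrC divfK // gt_eqF.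
by apply: lee_wpmul2l; [rewrite lee_fin ltW|exact: ltW].
Qed.

End hausdorff.

(** * Consequences of admissibility *)

Section admissible_theory.
Context (R : realType) (f : nat -> nat).
Hypothesis f_adm : admissible R f.

Lemma admissible_step (e : R) : 0 < e -> exists N, forall n, (N <= n)%N ->
  (f (n + f n)%N)%:R <= (1 + e) * (f n)%:R.
Proof.
move=> e0; have [f0 _ _ /cvgrPdist_le /(_ e e0)[N _ Ne]] := f_adm.
(* The shift by one makes n positive, hence also f n. *)
exists N.+1 => n Nn; have := Ne n (ltnW Nn).
have fn : 0 < (f n)%:R :> R by rewrite ltr0n f0 //; lia.
rewrite ler_norml => /andP[h _]; rewrite -ler_pdivrMr //; lra.
Qed.

(** Apply the one-step bound at p = n + j * f n, whose step f p is at least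
    f n. *)
Lemma admissible_iter j (e : R) : 0 < e -> exists N, forall n, (N <= n)%N ->
  (f (n + j * f n)%N)%:R <= (1 + e) * (f n)%:R.
Proof.
have [_ fmono _ _] := f_adm.
elim: j e => [|j IH] e e0.
  by exists 0%N => n _; rewrite mul0n addn0 ler_peMl // lerDl ltW.
(* With this choice (1 + e1) ^ 2 <= 1 + e. *)
pose e1 := Num.min 1 (e / 3).
have e10 : 0 < e1 by rewrite lt_min ltr01 divr_gt0.
have e11 : e1 <= 1 by rewrite ge_min lexx.
have e1e : e1 <= e / 3 by rewrite ge_min lexx orbT.
have [N1 h1] := IH e1 e10; have [N2 h2] := admissible_step e10.
exists (N1 + N2).+1 => n Nn; set p := (n + j * f n)%N.
have pn : (n <= p)%N by rewrite leq_addr.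
have n0 : (0 < n)%N by lia.
have fp : (f n <= f p)%N by exact: fmono.
apply: le_trans (_ : (f (p + f p)%N)%:R <= _).
  rewrite ler_nat fmono //; first by lia.
  by rewrite mulSn addnCA [leqLHS]addnC leq_add2l.
apply: le_trans (h2 p _) _; first by lia.
apply: le_trans (_ : (1 + e1) * ((1 + e1) * (f n)%:R) <= _).
  by rewrite ler_wpM2l ?addr_ge0 ?(ltW e10) // h1; lia.
rewrite mulrA ler_wpM2r //.
have : e1 * e1 <= e1 by rewrite ler_piMl // ltW.
by move=> ?; lra.
Qed.

Lemma admissible_slow M : exists N, forall n, (N <= n)%N ->
  (f (n + M * f n) <= 2 * f n)%N.
Proof.
have [N hN] := admissible_iter M (ltr01 : 0 < 1 :> R).
by exists N => n Nn; rewrite -(ler_nat R) natrM -natr1 addrC; exact: hN.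
Qed.

Lemma admissible_large (b : R) : exists N, forall n, (N <= n)%N ->
  b <= (f n)%:R.
Proof.
have [_ fmono funb _] := f_adm.
have [n n0 bn] := funb (Num.truncn b).+1.
exists n => m nm; apply: ltW.
apply: lt_le_trans (_ : (Num.truncn b).+1%:R <= _).
  exact: truncnS_gt.
by rewrite ler_nat ltnW // (leq_trans bn) // fmono.
Qed.

(** Let s k + f (s k) <= n < s k.+1 + f (s k.+1). The k-th planted run is
    complete, so the longest run is at least f (s k), and f n is at most
    f (s k.+1 + f (s k.+1)), which exceeds f (s k) by a factor close to 1. The
    upper bound is [run_length_schedule_le], where M / f n tends to 0. *)
Lemma run_length_ratio M lambda a : (1 < M)%N -> (0 < lambda)%N ->
  ((run_length n (insert_digits (schedule f M lambda) a) lambda)%:R /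
    (f n)%:R : R) @[n --> \oo] --> (1 : R).
Proof.
move=> M1 l0; have [f0 fmono _ _] := f_adm.
pose L n := run_length n (insert_digits (schedule f M lambda) a) lambda.
apply/cvgrPdist_le => e e0.
(* With this choice (1 + e1) ^ 2 <= 1 + e. *)
pose e1 := Num.min 1 (e / 3).
have e10 : 0 < e1 by rewrite lt_min ltr01 divr_gt0.
have e11 : e1 <= 1 by rewrite ge_min lexx.
have e1e : e1 <= e / 3 by rewrite ge_min lexx orbT.
have [N1 h1] := admissible_step e10; have [N2 h2] := admissible_iter M e10.
have [N3 h3] := admissible_large (M%:R / e).
pose s := run_start f M.
exists (N3 + s (N1 + N2).+1 + f (s (N1 + N2).+1))%N => // n Nn'.
have Nn : (N3 + s (N1 + N2).+1 + f (s (N1 + N2).+1) <= n)%N := Nn'.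
have s0 k : (0 < s k)%N by exact: run_start_gt0.
have n0 : (0 < n)%N by have := s0 (N1 + N2).+1; lia.
have fn : 0 < (f n)%:R :> R by rewrite ltr0n f0.
have up : (L n)%:R <= (f n)%:R + M%:R :> R.
  by rewrite -natrD ler_nat; exact: run_length_schedule_le.
have ex : exists k, (n < s k + f (s k))%N.
  by exists n; have := @run_start_gtn f M f0 M1 n; rewrite -/s; lia.
have [k nk kn] : exists2 k, (s k + f (s k) <= n)%N &
    (n < s k.+1 + f (s k.+1))%N.
  case: (ex_minnP ex) => -[|k] hk kmin.
    have m0 := @run_start_mono f M _ _ (leq0n (N1 + N2).+1).
    have := fmono _ _ (s0 0%N) m0; rewrite -/s in m0 *; lia.
  by exists k => //; rewrite leqNgt; apply/negP => /kmin; rewrite ltnn.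
have Nk : (N1 + N2 <= k)%N.
  rewrite leqNgt; apply/negP => kN.
  have m0 := @run_start_mono f M _ _ (kN : (k.+1 <= N1 + N2)%N).
  have m1 := @run_start_mono f M _ _ (leqnSn (N1 + N2)).
  have := fmono _ _ (s0 _) (leq_trans m0 m1); rewrite -/s in m0 m1 *; lia.
have ks := @run_start_gtn f M f0 M1 k; rewrite -/s in ks.
have ks1 := @run_start_gtn f M f0 M1 k.+1; rewrite -/s in ks1.
have low : (f n)%:R <= (1 + e1) * ((1 + e1) * (L n)%:R) :> R.
  apply: le_trans (_ : (f (s k.+1 + f (s k.+1)))%:R <= _).
    by rewrite ler_nat fmono // ltnW.
  apply: le_trans (h1 _ _) _; first by lia.
  rewrite ler_wpM2l ?addr_ge0 ?(ltW e10) //.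
  apply: le_trans (h2 (s k) _) _; first by lia.
  rewrite ler_wpM2l ?addr_ge0 ?(ltW e10) // ler_nat.
  exact: run_length_schedule_ge.
have Me : M%:R <= e * (f n)%:R.
  by rewrite mulrC -ler_pdivrMr // h3 //; lia.
have e11' : e1 * e1 <= e1 by rewrite ler_piMl // ltW.
have low' : (1 - e) * (f n)%:R <= (L n)%:R.
  have [e1'|e1'] := leP 1 e.
    apply: le_trans (_ : 0 <= _) => //.
    by rewrite mulr_le0_ge0 // ?subr_le0 // ltW.
  rewrite mulrA in low.
  have p0 : 0 < (1 + e1) * (1 + e1) by rewrite mulr_gt0 // addr_gt0.
  rewrite -(ler_pM2l p0); apply: le_trans low.
  rewrite mulrA -[leRHS]mul1r ler_wpM2r ?(ltW fn) //.
  apply: le_trans (_ : (1 + e) * (1 - e) <= _).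
    by rewrite ler_wpM2r ?subr_ge0 ?(ltW e1') //; lra.
  have : 0 <= e * e by rewrite mulr_ge0 // ltW.
  by move=> ?; lra.
rewrite ler_norml; apply/andP; split.
  have : (L n)%:R / (f n)%:R <= 1 + e.
    by rewrite ler_pdivrMr // mulrDl mul1r; lra.
  by rewrite /L => ?; lra.
have : 1 - e <= (L n)%:R / (f n)%:R by rewrite ler_pdivlMr.
by rewrite /L => ?; lra.
Qed.

End admissible_theory.

(** * The dimension of the set of prescribed run growth *)

Section final.
Context (R : realType).

Lemma longest_run_cfrac c n lambda : positive_digits c ->
  longest_run n (cfrac_tail R c 0) lambda = run_length n c lambda.
Proof.
move=> c0; apply: eq_bigr => j _; apply: eq_bigr => k _.
apply: eq_big_nat => i /andP[i1 _].
by rewrite partial_quotient_cfrac // addn_gt0 i1 orbT.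
Qed.

Lemma exists_rate (s : R) : 0 <= s < 1 ->
  exists2 rho : R, 1 < rho & rho ^+ 10 = 2 `^ (1 - s).
Proof.
move=> /andP[s0 s1]; exists (2 `^ ((1 - s) / 10)); last first.
  by rewrite -powR_mulrn ?powR_ge0 // -powRrM divfK.
rewrite -[ltLHS](powRr0 2) /powR !ifF ?pnatr_eq0 //.
rewrite ltr_expR ltr_pM2r ?ln_gt0 ?ltr1n // divr_gt0 // subr_gt0 //.
Qed.

(** Bernoulli's inequality. *)
Lemma exists_period (rho : R) (c : nat) : 1 < rho ->
  exists2 M : nat, (8 <= M)%N & c%:R <= rho ^+ M.
Proof.
move=> rho1.
have bern n : n%:R * (rho - 1) <= rho ^+ n.
  elim: n => [|n IH]; first by rewrite mul0r.
  rewrite exprS -natr1 mulrDl mul1r.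
  have : 1 <= rho ^+ n by apply: exprn_ege1; exact: ltW.
  move: (rho ^+ n) IH => t IH t1.
  have : (rho - 1) * 1 <= (rho - 1) * t by rewrite ler_wpM2l //; lra.
  by move=> ?; lra.
have r10 : 0 < rho - 1 by lra.
exists (8 + (Num.truncn (c%:R / (rho - 1))).+1)%N; first by rewrite leq_addr.
apply: le_trans (bern _); rewrite -ler_pdivrMr //.
apply: le_trans (ltW (truncnS_gt _)) _.
by rewrite ler_nat leq_addl.
Qed.

Lemma geometric_sum_le (rho : R) N : 1 < rho ->
  \sum_(0 <= n < N) (4 * rho / (rho - 1) * rho ^+ n)^-1 <= 4^-1.
Proof.
move=> rho1; have r10 : 0 < rho - 1 by lra.
have r0 : 0 < rho by lra.
suff -> : \sum_(0 <= n < N) (4 * rho / (rho - 1) * rho ^+ n)^-1 =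
  4^-1 * (1 - (rho ^+ N)^-1).
  by rewrite ler_piMr ?invr_ge0 // gerBl invr_ge0 exprn_ge0 // ltW.
elim: N => [|N IH]; first by rewrite big_nil expr0 invr1 subrr mulr0.
rewrite big_nat_recr //= IH exprS.
field; rewrite !gt_eqF ?exprn_gt0 //.
Qed.

End final.

Section lower_bound.
Context (R : realType).

Definition run_ratio_set (lambda : nat) (f : nat -> nat) : set R :=
  [set x : R | [/\ 0 <= x < 1, irrational x &
     ((longest_run n x lambda)%:R / (f n)%:R : R) @[n --> \oo] --> (1 : R)]].

Lemma run_ratio_set_insert lambda f M (a : nat -> nat) :
  (0 < lambda)%N -> admissible R f -> (1 < M)%N -> positive_digits a ->
  run_ratio_set lambda f
    (cfrac_tail R (insert_digits (schedule f M lambda) a) 0).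
Proof.
move=> l0 f_adm M1 a0; set c := insert_digits _ a.
have c0 : positive_digits c.
  exact: (@insert_digits_gt0 _ _ (@schedule_digit_bound f M lambda l0) a a0).
split.
- by rewrite ltW ?cfrac_tail_gt0 ?cfrac_tail_lt1.
- exact: cfrac_tail_irrational.
- under eq_fun do rewrite longest_run_cfrac //.
  exact: run_length_ratio.
Qed.

(** For the cost lambda + 2 of an insertion, rho is chosen from s, then M from
    rho; all the points of a set of positive outer measure are sent into the
    set by the insertion map. *)
Lemma hausdorff_measure_run_ratio_set lambda f (s : R) :
  (0 < lambda)%N -> admissible R f -> 0 <= s < 1 ->
  hausdorff_measure s (run_ratio_set lambda f) <> 0%E.
Proof.
move=> l0 f_adm s01 H0; have /andP[s0 s1] := s01.
have [f0 fmono _ _] := f_adm.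
have [rho rho1 rho10] := exists_rate s01.
have [M M8 CM] := exists_period (lambda.+2 ^ 4) rho1.
have M1 : (1 < M)%N by exact: leq_trans M8.
have [c0 ins] := inserted_count lambda f0 fmono M1 (admissible_slow f_adm M).
set sigma := schedule f M lambda.
have sigma_bnd := @schedule_digit_bound f M lambda l0.
have r10 : 0 < rho - 1 by rewrite subr_gt0.
pose K := 4 * rho / (rho - 1).
have K1 : 1 <= K by rewrite ler_pdivlMr //; lra.
have B1 n : 1 <= K * rho ^+ n.
  by rewrite -[leLHS]mulr1 ler_pM // exprn_ege1 // ltW.
have Sgt0 := bounded_digits_set_measure B1 (fun N => geometric_sum_le N rho1).
have [B B0 hoelder] := insert_map_hoelder sigma_bnd (ltn0Sn _) M8 ins K1
  (ltW rho1) CM s01 rho10.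
have := hausdorff_null_hoelder_preimage B0 s0 _ hoelder H0.
rewrite leNgt Sgt0 => h; suff : false by [].
apply: h => x [x01 xI _]; apply: run_ratio_set_insert => //.
exact: gauss_digits_gt0.
Qed.

End lower_bound.

Unset Implicit Arguments.

Theorem corollary1 (R : realType) (lambda : nat) (f : nat -> nat)
    (lambda_gt0 : (0 < lambda)%N) (f_adm : admissible R f) :
  hausdorff_dim
    [set x : R | [/\ 0 <= x < 1, irrational x &
       ((longest_run n x lambda)%:R / (f n)%:R : R) @[n --> \oo] --> (1 : R)]]
  = 1%E.
Proof.
rewrite -/(@run_ratio_set R lambda f).
apply/eqP; rewrite eq_le; apply/andP; split.
  apply/lee_addgt0Pr => e e0; apply: ereal_inf_lbound.
  exists (1 + e) => //; split; first by rewrite addr_ge0 // ltW.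
  by apply: hausdorff_measure_unit_itv => [|x []//]; rewrite ltrDl.
apply: le_ereal_inf_tmp => _ [s [s0 Hs] <-]; rewrite lee_fin leNgt.
apply/negP => s1; apply: hausdorff_measure_run_ratio_set Hs => //.
by rewrite s0.
Qed.
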